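(* Let $d \geq 3$ be an integer. (a) If $n \in [2d+1, 4d-1]$ is an odd integer, then $\underline{sa}_d^s(n) = 2d$. (b) If $n$ is an integer with $d+2 \leq n \leq 2d-1$, then $\underline{sa}_d^s(n) \geq 2d$. (c) If $X \in \mathcal{C}_d^s(2d)$, then either $P = \operatorname{conv} X$ is a cross-polytope, and then $sa(X) = d$, or else $sa(X) \geq 2d$.
   Context: Let $X=\{x_1,\dots,x_n\}\subset\mathbb{R}^d$ be a finite set (with $x_i\neq x_j$ for $i\ne j$) whose affine hull is $\mathbb{R}^d$, and let $P=\operatorname{conv}X$. Two distinct points $x_i,x_j\in X$ are strictly antipodal (in $X$) if there are different parallel supporting hyperplanes $H',H''$ of $P$ with $X\cap H'=\{x_i\}$ and $X\cap H''=\{x_j\}$. $sa(X)$ is the number of (unordered) strictly antipodal pairs of $X$. $X$ is in strictly convex position if $X=\operatorname{vert}P$ (the vertex set of $P$). $\mathcal{C}_d^s(n)$ is the family of all $X\subset\mathbb{R}^d$ with $|X|=n$, $\operatorname{aff}X=\mathbb{R}^d$, $X$ in strictly convex position, and $\underline{sa}_d^s(n):=\min\{sa(X)\mid X\in\mathcal{C}_d^s(n)\}$. A cross-polytope in $\mathbb{R}^d$ is understood in the affine sense: $\operatorname{conv}\{p\pm v_i\mid 1\le i\le d\}$ with $v_1,\dots,v_d$ linearly independent. *)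

(* Defs.v *)
From HB Require Import structures.
From mathcomp Require Import all_boot all_order all_algebra finmap.
From mathcomp Require Import boolp classical_sets reals convex.

Set Implicit Arguments.
Unset Strict Implicit.
Unset Printing Implicit Defensive.

Import Order.TTheory GRing.Theory Num.Theory.

Local Open Scope classical_set_scope.
Local Open Scope ring_scope.

Section Defs.
Context {R : realType} {d : nat}.
Implicit Types (X : {fset 'rV[R]_d}) (P H : set 'rV[R]_d).

Definition convex_hull (A : set 'rV[R]_d) : set 'rV[R]_d := smallest (@convex_set R 'rV[R]_d) A.

Definition affine_hull X : set 'rV[R]_d :=
  [set y | exists w : 'rV[R]_d -> R,
     \sum_(x <- X) w x = 1 /\ y = \sum_(x <- X) w x *: x].

(* A hyperplane only when a != 0. *)
Definition hyperplane (a : 'cV[R]_d) (b : R) : set 'rV[R]_d :=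
  [set x | (x *m a) 0 0 = b].

Definition supporting_hyperplane P H : Prop :=
  exists (a : 'cV[R]_d) (b : R),
    [/\ a != 0, H = hyperplane a b,
        P `<=` [set x | (x *m a) 0 0 <= b] & P `&` H !=set0].

Definition parallel H1 H2 : Prop :=
  exists (a : 'cV[R]_d) (b1 b2 : R),
    [/\ a != 0, H1 = hyperplane a b1 & H2 = hyperplane a b2].

(* The vertices are the faces of dimension 0. *)
Definition vert P : set 'rV[R]_d :=
  [set v | exists2 H, supporting_hyperplane P H & P `&` H = [set v]].

Definition strictly_antipodal X (x y : 'rV[R]_d) : Prop :=
  [/\ x \in X, y \in X, x != y &
    exists H1 H2 : set 'rV[R]_d,
      [/\ supporting_hyperplane (convex_hull [set` X]) H1 /\
          supporting_hyperplane (convex_hull [set` X]) H2,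
          parallel H1 H2, H1 <> H2,
          [set` X] `&` H1 = [set x] & [set` X] `&` H2 = [set y]]].

(* Unordered pairs are represented by the subsets {x, y} of X. *)
Definition sa X : nat :=
  #|` [fset A in fpowerset X |
        `[< exists x y, strictly_antipodal X x y /\ A = [fset x; y] >]] |%fset.

Definition strictly_convex_position X : Prop :=
  [set` X] = vert (convex_hull [set` X]).

Definition cross_polytope P : Prop :=
  exists (p : 'rV[R]_d) (v : 'M[R]_d), row_free v /\
    P = convex_hull
      (range (fun i => p + row i v) `|` range (fun i => p - row i v)).

End Defs.

Definition Cs (R : realType) (d n : nat) : set {fset 'rV[R]_d} :=
  [set X | [/\ #|` X|%fset = n, affine_hull X = setT
            & strictly_convex_position X]].

Arguments Cs : clear implicits.

(* The value is 0 when Cs R d n is empty, that is, has no minimum to take. *)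
Definition sa_min (R : realType) (d n : nat) : nat :=
  let values := [set sa X | X in Cs R d n] in
  xget 0%N (values `&` lbound values).

(* Main.v *)
(** For a direction [u] in general position let [x] and [y] be the points of [X]
    at which [u] attains its maximum and its minimum.  The vertices of the
    difference body [P - P] are the differences [k = x - y], so [2 * sa X] is their
    number; put [g = x + y] for the same pairs.  Then [g] is even, and along every
    edge of [P - P] the difference of the [g]'s is a multiple of the difference of
    the [k]'s.  If [g] is constant, then [X] is centrally symmetric, hence [n] is
    even, [n >= 2d], and [n = 2d] gives a cross-polytope.  If [g] is not constant,
    then [P - P] has at least [4d] vertices ([6] for [d = 2]), by induction on [d].
    Indeed, if [g] differs at [k] and [k'], then [k] cannot be joined by edges both
    to [k'] and to [-k'] (the difference of the [g]'s would be a multiple of both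
    [k - k'] and [k + k']), and the projection along a generic perturbation of such
    a non-edge destroys the four vertices [k, -k, k', -k'].  Either [g] is still not
    constant on the vertices that survive, or all these lie in one level set of
    [g], and then one counts the edges that leave this level set (if the values of
    [g] lie in a hyperplane, one chooses the direction so that the first case
    occurs).  For [d = 3] six
    vertices have to be destroyed: one projects parallel to a face with at least
    four vertices, in a direction that also points into [P - P] from a vertex that
    is on neither this face nor its opposite.

    The examples for odd [n] are the cross-polytope with an additional vertex
    [-v], where [v] is the sum of the basis divided by [d - 1]; [v] and the basis
    vectors can be truncated without creating further strictly antipodal pairs. *)
Require Import Defs.
From mathcomp Require Import boolp classical_sets reals convex interval_inference unstable.
From mathcomp Require Import all_boot all_order all_algebra finmap.
From mathcomp Require Import ring lra zify.

Set Implicit Arguments.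
Unset Strict Implicit.
Unset Printing Implicit Defensive.

Import Order.TTheory GRing.Theory Num.Theory.

Local Open Scope ring_scope.

(** * Inner products and generic choices *)

Section Dot.
Context {R : realFieldType}.

Definition dot d (x : 'rV[R]_d) (u : 'cV[R]_d) : R := (x *m u) 0 0.

Lemma dotDl d (x y : 'rV[R]_d) u : dot (x + y) u = dot x u + dot y u.
Proof. by rewrite /dot mulmxDl mxE. Qed.
Lemma dotDr d (x : 'rV[R]_d) u v : dot x (u + v) = dot x u + dot x v.
Proof. by rewrite /dot mulmxDr mxE. Qed.
Lemma dotNl d (x : 'rV[R]_d) u : dot (- x) u = - dot x u.
Proof. by rewrite /dot mulNmx mxE. Qed.
Lemma dotNr d (x : 'rV[R]_d) u : dot x (- u) = - dot x u.
Proof. by rewrite /dot mulmxN mxE. Qed.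
Lemma dotZl d a (x : 'rV[R]_d) u : dot (a *: x) u = a * dot x u.
Proof. by rewrite /dot -scalemxAl mxE. Qed.
Lemma dotZr d a (x : 'rV[R]_d) u : dot x (a *: u) = a * dot x u.
Proof. by rewrite /dot -scalemxAr mxE. Qed.
Lemma dot0l d (u : 'cV[R]_d) : dot 0 u = 0.
Proof. by rewrite /dot mul0mx mxE. Qed.
Lemma dot0r d (x : 'rV[R]_d) : dot x 0 = 0.
Proof. by rewrite /dot mulmx0 mxE. Qed.
Definition dotE := (dotDl, dotDr, dotNl, dotNr, dotZl, dotZr, dot0l, dot0r).

Lemma dot_sum d (I : finType) (F : I -> 'rV[R]_d) u :
  dot (\sum_i F i) u = \sum_i dot (F i) u.
Proof. by rewrite /dot mulmx_suml summxE. Qed.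

Lemma dot_mul d d' (x : 'rV[R]_d) (B : 'M[R]_(d, d')) u :
  dot (x *m B) u = dot x (B *m u).
Proof. by rewrite /dot mulmxA. Qed.

Lemma dot_eq0l d (x : 'rV[R]_d) : (forall u, dot x u = 0) -> x = 0.
Proof.
move=> x0; apply/rowP => j; rewrite mxE -(x0 (delta_mx j 0)) /dot mxE.
rewrite (bigD1 j) //= big1 ?mxE ?eqxx ?mulr1 ?addr0 //.
by move=> i ij; rewrite mxE (negbTE ij) mulr0.
Qed.

Lemma dot_eq0r d (u : 'cV[R]_d) : (forall x, dot x u = 0) -> u = 0.
Proof.
move=> x0; apply/colP => j; rewrite mxE -(x0 (delta_mx 0 j)) /dot mxE.
rewrite (bigD1 j) //= big1 ?mxE ?eqxx ?mul1r ?addr0 //.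
by move=> i ij; rewrite mxE (negbTE ij) andbF mul0r.
Qed.

Lemma dot_neq0l d (x : 'rV[R]_d) : x != 0 -> exists u, 0 < dot x u.
Proof.
move=> xn0; apply: contrapT => no; move/eqP: xn0; apply; apply: dot_eq0l => u.
apply/eqP; rewrite eq_le; apply/andP; split; rewrite leNgt; apply/negP => h; apply: no.
  by exists u.
by exists (- u); rewrite dotNr oppr_gt0.
Qed.

Lemma dot_neq0r d (u : 'cV[R]_d) : u != 0 -> exists x, 0 < dot x u.
Proof.
move=> xn0; apply: contrapT => no; move/eqP: xn0; apply; apply: dot_eq0r => x.
apply/eqP; rewrite eq_le; apply/andP; split; rewrite leNgt; apply/negP => h; apply: no.
  by exists x.
by exists (- x); rewrite dotNl oppr_gt0.
Qed.

(** Every [v] becomes orthogonal to [x] after subtracting a multiple of one fixed [v0] with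
    [dot x v0 > 0], so the value at [v0] determines [y]. *)
Lemma colinear_dot d (x y : 'rV[R]_d) : x != 0 ->
  (forall v, dot x v = 0 -> dot y v = 0) -> exists t, y = t *: x.
Proof.
move=> /dot_neq0l [v0 xv0] xy; exists (dot y v0 / dot x v0).
have xn0 := lt0r_neq0 xv0.
apply/eqP; rewrite -subr_eq0; apply/eqP/dot_eq0l => v.
have := xy (v - (dot x v / dot x v0) *: v0); rewrite !dotE.
have -> : dot x v - dot x v / dot x v0 * dot x v0 = 0 by field.
move=> /(_ erefl) h; rewrite -[RHS]h; field; exact: xn0.
Qed.

Lemma not_colinear_dot d (x y : 'rV[R]_d) : x != 0 ->
  ~ (exists t, y = t *: x) -> exists v, dot x v = 0 /\ 0 < dot y v.
Proof.
move=> x0 nc; apply: contrapT => no; apply: nc; apply: colinear_dot => // v xv.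
apply/eqP; rewrite eq_le; apply/andP; split; rewrite leNgt; apply/negP => h; apply: no.
  by exists v.
by exists (- v); rewrite !dotNr xv oppr0 oppr_gt0.
Qed.

Lemma exists_annihilator d (I : finType) (D : {set I}) (x : I -> 'rV[R]_d) :
  (#|D| < d)%N -> exists2 n : 'cV[R]_d, n != 0 & forall i, i \in D -> dot (x i) n = 0.
Proof.
move=> Dd; pose A : 'M[R]_(#|D|, d) := \matrix_(i < #|D|) x (enum_val i).
have : kermx A^T != 0.
  rewrite -mxrank_eq0 mxrank_ker mxrank_tr -lt0n subn_gt0.
  exact: leq_ltn_trans (rank_leq_row A) Dd.
case/rowV0Pn => v /sub_kermxP vA v0; exists v^T; first by rewrite trmx_eq0.
move=> i iD; have : A *m v^T = 0 by rewrite -[A]trmxK -trmx_mul vA trmx0.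
move/colP/(_ (enum_rank_in iD i)); rewrite !mxE => h; rewrite /dot !mxE -[RHS]h.
by apply: eq_bigr => j _; rewrite !mxE enum_rankK_in.
Qed.

(** [B] is the projection along [w]. It is built from a basis of the orthogonal complement of [w],
    so functionals on the quotient correspond to the [u] with [dot w u = 0]. *)
Lemma exists_quotient d (w : 'rV[R]_d.+1) : w != 0 ->
  exists B : 'M[R]_(d.+1, d),
    [/\ w *m B = 0, forall u, dot w u = 0 -> exists u', u = B *m u',
        forall u' : 'cV[R]_d, B *m u' = 0 -> u' = 0
      & forall x : 'rV[R]_d.+1, x *m B = 0 -> exists t, x = t *: w].
Proof.
move=> w0.
have rk : \rank (kermx w^T) = d.
  by rewrite mxrank_ker mxrank_tr rank_rV w0 subn1.
have [C [Cf CE]] : exists C : 'M[R]_(d, d.+1), row_free C /\ (C :=: kermx w^T)%MS.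
  move: (row_base (kermx w^T)) (row_base_free (kermx w^T)) (eq_row_base (kermx w^T)).
  by rewrite rk => C ? ?; exists C.
have wC : w *m C^T = 0.
  apply: trmx_inj; rewrite trmx_mul trmxK trmx0.
  by apply/sub_kermxP; rewrite CE.
have p2 u : dot w u = 0 -> exists u', u = C^T *m u'.
  move=> wu; have : (u^T <= C)%MS.
    rewrite CE; apply/sub_kermxP; rewrite -trmx_mul; apply: trmx_inj.
    by rewrite trmxK trmx0; apply/matrixP => i j; rewrite !ord1 -/(dot w u) wu mxE.
  by case/submxP => D DE; exists D^T; rewrite -trmx_mul -DE trmxK.
exists C^T; split=> //.
  move=> u' /(congr1 trmx); rewrite trmx_mul trmxK trmx0 => /eqP.
  rewrite mulmx_free_eq0 // => /eqP /(congr1 trmx); by rewrite trmxK trmx0.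
move=> x xB; apply: colinear_dot => // v /p2 [u' ->].
by rewrite -dot_mul xB dot0l.
Qed.

(** * Properties of all sufficiently small positive numbers *)

Definition near0 (P : R -> Prop) := exists2 e0, 0 < e0 & forall e, 0 < e < e0 -> P e.

Lemma near0T (P : R -> Prop) : (forall e, P e) -> near0 P.
Proof. by move=> h; exists 1. Qed.

Lemma near0_and P Q : near0 P -> near0 Q -> near0 (fun e => P e /\ Q e).
Proof.
move=> [a a0 Pa] [b b0 Qb]; exists (Num.min a b); first by rewrite lt_min a0.
by move=> e /andP[e0]; rewrite lt_min => /andP[ea eb]; split; [apply: Pa|apply: Qb]; rewrite e0.
Qed.

Lemma near0_sub (P Q : R -> Prop) : (forall e, 0 < e -> P e -> Q e) -> near0 P -> near0 Q.
Proof. by move=> h [a a0 Pa]; exists a => // e ea; apply: h; [case/andP: ea|exact: Pa]. Qed.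

Lemma near0_seq (T : eqType) (s : seq T) (P : T -> R -> Prop) :
  (forall i, i \in s -> near0 (P i)) -> near0 (fun e => forall i, i \in s -> P i e).
Proof.
elim: s => [|a s IH] h; first by exists 1.
have := near0_and (h a (mem_head _ _)) (IH (fun i is_ => h i (mem_behead (s:=a::s) is_))).
by apply: near0_sub => e _ [Pa Ps] i; rewrite inE => /orP[/eqP->//|]; apply: Ps.
Qed.

Lemma near0_fin (I : finType) (P : I -> R -> Prop) :
  (forall i, near0 (P i)) -> near0 (fun e => forall i, P i e).
Proof.
move=> h; have := @near0_seq I (enum I) P (fun i _ => h i).
by apply: near0_sub => e _ H i; apply: H; rewrite mem_enum.
Qed.

Lemma near0_ex P : near0 P -> exists2 e, 0 < e & P e.
Proof. by move=> [a a0 Pa]; exists (a / 2); [|apply: Pa]; lra. Qed.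

Lemma near0_lt a : 0 < a -> near0 (fun e => e < a).
Proof. by move=> a0; exists a => // e /andP[]. Qed.

Lemma near0_pos a b : 0 < a -> near0 (fun e => 0 < a + e * b).
Proof.
move=> a0; have n0 : 0 < `|b| + 1 by have := normr_ge0 b; lra.
exists (a / (`|b| + 1)); first exact: divr_gt0.
move=> e /andP[e0]; rewrite ltr_pdivlMr // => h.
have : - (e * b) <= e * `|b|.
  by rewrite -mulrN; apply: ler_wpM2l; [exact: ltW|rewrite -normrN ler_norm].
nra.
Qed.

Lemma near0_neq0 a b : (a != 0) || (b != 0) -> near0 (fun e => a + e * b != 0).
Proof.
case: (ltrgtP a 0) => [a0 _|a0 _|-> /=].
- have : 0 < - a by lra.
  move/(near0_pos (- b)); apply: near0_sub => e _ h; rewrite -oppr_eq0 opprD gt_eqF //.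
  by rewrite -mulrN.
- by move: a0 => /(near0_pos b); apply: near0_sub => e _ h; rewrite gt_eqF.
- move=> b0; exists 1 => // e /andP[e0 _]; rewrite add0r mulf_neq0 //.
  by rewrite gt_eqF.
Qed.

Lemma near0_avoid (P : R -> Prop) :
  (forall a b, P a -> P b -> a = b) -> near0 (fun e => ~ P e).
Proof.
move=> uP; have [[a [a0 Pa]]|no] := pselect (exists a, 0 < a /\ P a).
  exists a => // e /andP[e0 ea] Pe; have := uP _ _ Pa Pe; lra.
by exists 1 => // e /andP[e0 _] Pe; apply: no; exists e.
Qed.

Lemma generic_vector d (s : seq 'rV[R]_d) :
  exists v, forall x, x \in s -> x != 0 -> dot x v != 0.
Proof.
elim: s => [|a s [v IH]]; first by exists 0.
have [->|/dot_neq0l [b ab]] := eqVneq a 0.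
  by exists v => x; rewrite inE => /orP[/eqP->|/IH//]; rewrite eqxx.
suff : near0 (fun e => forall x, x \in a :: s -> x != 0 -> dot x (v + e *: b) != 0).
  by case/near0_ex => e _ h; exists (v + e *: b).
apply: near0_seq => x; rewrite inE => /orP xs.
have [->|x0] := eqVneq x 0; first by apply: near0T.
have : near0 (fun e => dot x v + e * dot x b != 0).
  apply: near0_neq0; case: xs => [/eqP->|/IH ->//]; by rewrite (gt_eqF ab) orbT.
by apply: near0_sub => e _ h _; rewrite !dotE.
Qed.

End Dot.

(** * Finite point sets and their exposed points *)

Section Points.
Context {R : realFieldType} {d : nat} {I : finType}.
Implicit Types (k g : I -> 'rV[R]_d) (u v : 'cV[R]_d).

Definition maxat k u i := forall j, dot (k j) u <= dot (k i) u.
Definition exposedat k u i := forall j, j != i -> dot (k j) u < dot (k i) u.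

Lemma exposedat_max k u i : exposedat k u i -> maxat k u i.
Proof. by move=> h j; have [->//|/h/ltW] := eqVneq j i. Qed.

Lemma exposedat_near0 k u i v : exposedat k u i -> near0 (fun e => exposedat k (u + e *: v) i).
Proof.
move=> h; have : near0 (fun e => forall j, j != i -> 0 < dot (k i - k j) u + e * dot (k i - k j) v).
  apply: near0_fin => j; have [->|ji] := eqVneq j i; first exact: near0T.
  have : 0 < dot (k i - k j) u by have := h j ji; rewrite !dotE; lra.
  by move=> /(near0_pos (dot (k i - k j) v)); apply: near0_sub.
by apply: near0_sub => e _ H j /H; rewrite !dotE; nra.
Qed.

Lemma exposed_inj k : (forall i, exists u, exposedat k u i) -> injective k.
Proof.
move=> h i j kij; apply/eqP; apply: contrapT => /negP ij.
by have [u /(_ j)] := h i; rewrite eq_sym ij kij ltxx => /(_ isT).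
Qed.

Lemma generic_injective k : injective k ->
  exists v, forall i j, i != j -> dot (k i) v != dot (k j) v.
Proof.
move=> kI; have [v hv] := generic_vector [seq k p.1 - k p.2 | p <- enum {: I * I}].
exists v => i j ij; rewrite -subr_eq0; have <- : dot (k i - k j) v = dot (k i) v - dot (k j) v.
  by rewrite !dotE.
apply: hv; last by rewrite subr_eq0; apply: contra ij => /eqP/kI->.
by apply/mapP; exists (i, j); rewrite ?mem_enum.
Qed.

(** A lexicographic choice: among the maximizers of [u] take the one with the largest value at [v],
    which breaks all ties. *)
Lemma exposed_maximizer_generic k u v (i0 : I) :
  (forall i j, i != j -> dot (k i) v != dot (k j) v) ->
  exists i, maxat k u i /\ near0 (fun e => exposedat k (u + e *: v) i).
Proof.
move=> hv.
case: (@arg_maxP _ _ _ i0 predT (fun i => dot (k i) u) isT) => i1 _ h1.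
case: (@arg_maxP _ _ _ i1 [pred i | dot (k i) u == dot (k i1) u] (fun i => dot (k i) v) (eqxx _)).
move=> i /eqP ii1 h2; exists i; split; first by move=> j; rewrite ii1; apply: h1.
have : near0 (fun e => forall j, j != i -> 0 < dot (k i - k j) u + e * dot (k i - k j) v).
  apply: near0_fin => j; have [->|ji] := eqVneq j i; first exact: near0T.
  have := h1 j isT; rewrite -ii1 /= le_eqVlt => /orP[/eqP ju|ju].
    apply: (@near0_sub _ (fun e => 0 < e)); last by exists 1 => // e /andP[].
    move=> e e0 _ _; have := h2 j; rewrite inE ju ii1 eqxx => /(_ isT) /= hle.
    have := hv j i ji; rewrite !dotE => hne.
    have lt : dot (k j) v < dot (k i) v by rewrite lt_neqAle hne hle.
    by rewrite ju ii1; nra.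
  have : 0 < dot (k i - k j) u by rewrite !dotE; lra.
  by move=> /(near0_pos (dot (k i - k j) v)); apply: near0_sub.
by apply: near0_sub => e _ H j /H; rewrite !dotE; nra.
Qed.

Lemma exposed_maximizer k u (i0 : I) : injective k ->
  exists i, maxat k u i /\ exists u', exposedat k u' i.
Proof.
move=> /generic_injective [v /(exposed_maximizer_generic u i0)] [i [mi /near0_ex [e _ h]]].
by exists i; split=> //; exists (u + e *: v).
Qed.

(** Two points on each ray from [u] suffice. The lemma serves to identify values of [g] by comparing
    them on all directions near one that exposes a given vertex. *)
Lemma eq_open (x : 'rV[R]_d) u : (forall v, near0 (fun e => dot x (u + e *: v) = 0)) -> x = 0.
Proof.
move=> h; apply: dot_eq0l => v; have [a a0 ha] := h v.
have := ha (a / 2); have := ha (a / 4); rewrite !dotE.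
move=> /(_ ltac:(lra)) h1 /(_ ltac:(lra)) h2.
have : a * dot x v = 0 by lra.
by move/eqP; rewrite mulf_eq0 gt_eqF //= => /eqP.
Qed.

Definition colinear (x y : 'rV[R]_d) := exists t, y = t *: x.

(** Of three points on a line the middle one is not exposed: the direction exposing [k i] gives
    [0 < s], that of [k j] gives [s < 1], and that of [k l] excludes both together. *)
Lemma exposed_notcolinear k : (forall i, exists u, exposedat k u i) ->
  forall i j l, i != j -> l != i -> l != j -> ~ colinear (k j - k i) (k l - k i).
Proof.
move=> hx i j l ij li lj [s E].
have [ui hi] := hx i; have [uj hj] := hx j; have [ul hl] := hx l.
have D u : dot (k l) u = dot (k i) u + s * (dot (k j) u - dot (k i) u).
  by have := congr1 (fun x => dot x u) E; rewrite !dotE; lra.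
have := hi j; have := hi l; rewrite li eq_sym ij D => /(_ isT) h1 /(_ isT) h2.
have := hj i; have := hj l; rewrite lj ij D => /(_ isT) h3 /(_ isT) h4.
have := hl i; have := hl j; rewrite !(eq_sym _ l) li lj D => /(_ isT) h5 /(_ isT) h6.
clear E D hi hj hl.
have s0 : 0 < s by nra.
have s1 : s < 1 by nra.
nra.
Qed.

(** For [i = j] this says that [k i] is exposed, hence the separate conditions [i != j] below. *)
Definition edge k i j := exists u, dot (k i) u = dot (k j) u /\
  forall l, l != i -> l != j -> dot (k l) u < dot (k i) u.

Lemma edge_sym k i j : edge k i j -> edge k j i.
Proof. by move=> [u [e h]]; exists u; split=> // l li lj; rewrite -e; apply: h. Qed.

(** Gordan's alternative, by induction on the number of vectors. If the [u] found for the other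
    vectors is negative on [a l0], these are shifted by positive multiples of [a l0] into the
    orthogonal complement of [u], and the induction hypothesis is applied once more. *)
Lemma gordan (P : {set I}) (a : I -> 'rV[R]_d) :
  (exists u, forall l, l \in P -> 0 < dot (a l) u) \/
  (exists c : I -> R, [/\ forall l, 0 <= c l, forall l, l \notin P -> c l = 0,
     0 < \sum_l c l & \sum_l c l *: a l = 0]).
Proof.
have [n nP] := ubnP #|P|; elim: n => // n IH in P nP a *.
have [->|[l0 l0P]] := set_0Vmem P; first by left; exists 0 => l; rewrite inE.
have PE : (#|P :\ l0| < n)%N by move: nP; rewrite (cardsD1 l0) l0P ltnS add1n.
pose b0 := dot (a l0).
have [[u hu]|[c [c0 cP cs ca]]] := IH _ PE a; last first.
  by right; exists c; split=> // l lP; apply: cP; rewrite inE (negbTE lP) andbF.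
have [a0|an0] := eqVneq (a l0) 0.
  right; exists (fun l => (l == l0)%:R); split.
  - by move=> l; rewrite ler0n.
  - by move=> l; case: eqP => // ->; rewrite l0P.
  - by rewrite (bigD1 l0) //= eqxx big1 ?addr0 ?ltr01 // => l /negbTE->.
  - by rewrite (bigD1 l0) //= eqxx a0 scaler0 add0r big1 // => l /negbTE->; rewrite scale0r.
have [h|h|h] := ltrgtP (dot (a l0) u) 0; last first.
- have [x hx] := dot_neq0l an0; left.
  have : near0 (fun e => forall l, l \in P -> 0 < dot (a l) u + e * dot (a l) x).
    apply: near0_fin => l; have [->|ll0] := eqVneq l l0.
      by exists 1 => // e /andP[e0 _] _; rewrite h add0r mulr_gt0.
    have [lP|] := boolP (l \in P); last by move=> _; apply: near0T.
    have : 0 < dot (a l) u by apply: hu; rewrite !inE ll0.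
    by move=> /(near0_pos (dot (a l) x)); apply: near0_sub.
  case/near0_ex => e _ H; exists (u + e *: x) => l /H; by rewrite !dotE.
- by left; exists u => l lP; have [->//|ll0] := eqVneq l l0; apply: hu; rewrite !inE ll0.
have hn : dot (a l0) u != 0 by rewrite lt_eqF.
pose c l := - (dot (a l) u / dot (a l0) u).
have cpos l : l \in P :\ l0 -> 0 < c l.
  by move/hu => ha; rewrite /c -mulrN -invrN; apply: divr_gt0 => //; lra.
pose b l := a l + c l *: a l0.
have bu l : dot (b l) u = 0 by rewrite /b /c !dotE; field.
have [[u' hu']|[e [e0 eP es ea]]] := IH _ PE b; last first.
  right; pose S := \sum_(l | l != l0) e l * c l.
  have el0 : e l0 = 0 by apply: eP; rewrite !inE eqxx.
  have S0 : 0 <= S.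
    apply: sumr_ge0 => l ll0; have [/cpos/ltW lP|/eP->] := boolP (l \in P :\ l0).
      exact: mulr_ge0.
    by rewrite mul0r.
  exists (fun l => if l == l0 then S else e l); split.
  - by move=> l; case: ifP.
  - move=> l lP; case: eqP => [E|_]; first by rewrite E l0P in lP.
    by apply: eP; rewrite inE (negbTE lP) andbF.
  - rewrite (bigD1 l0) //= eqxx; rewrite (bigD1 l0) //= el0 add0r in es.
    apply: (lt_le_trans es); rewrite -[leLHS]add0r; apply: lerD => //.
    by apply: ler_sum => l /negbTE->.
  - rewrite (bigD1 l0) //= eqxx -[RHS]ea (bigD1 l0 (F := fun l => e l *: b l)) //= el0 scale0r add0r.
    rewrite scaler_suml -big_split /=; apply: eq_bigr => l /negbTE->.
    by rewrite /b scalerDr scalerA addrC.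
(* [v] vanishes on [a l0] and is positive on the other vectors; a small step along [- u] makes it
   positive on [a l0] too. *)
pose v := u' - (dot (a l0) u' / dot (a l0) u) *: u.
have v0 : dot (a l0) v = 0 by rewrite /v !dotE; field.
have vl l : l \in P :\ l0 -> 0 < dot (a l) v.
  move=> lP; have -> : dot (a l) v = dot (b l) v by rewrite [dot (b l) v]dotDl dotZl v0 mulr0 addr0.
  by rewrite /v dotDr dotNr dotZr bu mulr0 subr0; apply: hu'.
left; have : near0 (fun e => forall l, l \in P -> 0 < dot (a l) v + e * (- dot (a l) u)).
  apply: near0_fin => l; have [->|ll0] := eqVneq l l0.
    by exists 1 => // e /andP[e0 _] _; rewrite v0 add0r mulr_gt0 // oppr_gt0.
  have [lP|] := boolP (l \in P); last by move=> _; apply: near0T.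
  have : 0 < dot (a l) v by apply: vl; rewrite !inE ll0.
  by move=> /(near0_pos (- dot (a l) u)); apply: near0_sub.
case/near0_ex => e _ H; exists (v - e *: u) => l /H; rewrite !dotE.
by rewrite mulrN.
Qed.

End Points.

(** * Edges and non-edges of a polytope *)

Section Polytope.
Context {R : realFieldType} {d : nat} {I : finType}.
Implicit Types (k g : I -> 'rV[R]_d.+1) (u v : 'cV[R]_d.+1).

(* The point [k i - c *: (k i - k j)] of the segment is a convex combination of the
   other points in which [k f] has weight [lam]; the estimate is what remains of it. *)
Lemma nonedge_combination k i j : (forall i, exists u, exposedat k u i) ->
  i != j -> ~ edge k i j ->
  exists (c : R) (lam : R) (f : I), [/\ 0 < c < 1, 0 < lam <= 1, f != i, f != j &
    forall u M, (forall l, dot (k l) u <= M) ->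
      lam * (M - dot (k f) u) <= M - (dot (k i) u - c * dot (k i - k j) u)].
Proof.
move=> kx ij ne; have kI := exposed_inj kx.
have w0 : k i - k j != 0 by rewrite subr_eq0; apply: contra ij => /eqP/kI->.
have [B [wB B1 B2 B3]] := exists_quotient w0.
(* After projection along [k i - k j], a functional positive on all these differences would exhibit
   an edge. The other alternative is a convex combination of the remaining points on the line
   through [k i] and [k j]. *)
have [[u' hu']|[c [c0 cP cs ca]]] := gordan (~: [set i; j]) (fun l => (k i - k l) *m B).
  case: ne; exists (B *m u'); split.
    apply/eqP; rewrite -subr_eq0 -dotNl -dotDl; apply/eqP.
    by rewrite -dot_mul wB dot0l.
  move=> l li lj; have := hu' l; rewrite !inE (negbTE li) (negbTE lj) => /(_ isT).
  by rewrite dot_mul !dotE subr_gt0.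
set S := \sum_l c l in cs.
have S0 := lt0r_neq0 cs.
have [t tE] : exists t, \sum_l c l *: (k i - k l) = t *: (k i - k j).
  apply: B3; rewrite mulmx_suml -[RHS]ca; apply: eq_bigr => l _.
  by rewrite scalemxAl.
pose lam l := c l / S.
have lam0 l : 0 <= lam l by apply: divr_ge0 => //; exact: ltW.
have lamS : \sum_l lam l = 1 by rewrite -mulr_suml divff.
have ci : c i = 0 by apply: cP; rewrite !inE eqxx.
have cj : c j = 0 by apply: cP; rewrite !inE eqxx orbT.
have yE u : \sum_l lam l * dot (k l) u = dot (k i) u - t / S * dot (k i - k j) u.
  have := congr1 (fun x => dot x u) tE; rewrite dot_sum dotZl => h.
  have -> : t / S * dot (k i - k j) u = (\sum_l dot (c l *: (k i - k l)) u) / S.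
    by rewrite h; field.
  rewrite mulr_suml -[dot (k i) u]mul1r -lamS mulr_suml -GRing.sumrB.
  by apply: eq_bigr => l _; rewrite !dotE /lam; field.
have avg f u M : (forall l, dot (k l) u <= M) ->
    lam f * (M - dot (k f) u) <= M - (dot (k i) u - t / S * dot (k i - k j) u).
  move=> hM; rewrite -yE.
  have -> : M - \sum_l lam l * dot (k l) u = \sum_l lam l * (M - dot (k l) u).
    under [RHS]eq_bigr do rewrite mulrBr.
    by rewrite sumrB -mulr_suml lamS mul1r.
  rewrite (bigD1 f) //= lerDl; apply: sumr_ge0 => l _.
  by rewrite mulr_ge0 // subr_ge0.
have [f fpos] : exists f, 0 < lam f.
  apply: contrapT => no; have : \sum_l lam l <= 0.
    apply: sumr_le0 => l _; rewrite leNgt; apply/negP => h; apply: no; by exists l.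
  by rewrite lamS ler10.
have fi : f != i by apply: contraTneq fpos => ->; rewrite /lam ci mul0r ltxx.
have fj : f != j by apply: contraTneq fpos => ->; rewrite /lam cj mul0r ltxx.
exists (t / S), (lam f), f; split=> //; last by move=> u M; apply: avg.
  (* The directions exposing [k i] and [k j] place the combination strictly between the two
     points. *)
  have [ui hi] := kx i; have [uj hj] := kx j.
  have := avg f ui _ (exposedat_max hi); have := avg f uj _ (exposedat_max hj).
  have := hi f fi; have := hi j; rewrite eq_sym ij => /(_ isT).
  have := hj f fj; have := hj i ij; rewrite !dotE => h1 h2 h3 h4 h5 h6.
  have := mulr_gt0 fpos; rewrite -subr_gt0 in h2; rewrite -subr_gt0 in h4.
  move=> H; have := H _ h2; have := H _ h4; move=> h7 h8.
  apply/andP; split; nra.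
rewrite fpos -lamS (bigD1 f) //= lerDl; exact: sumr_ge0.
Qed.

(* If [u] is orthogonal to [k i - k j + s *: rho], then [k i] is exposed by [u] only
   if it survives the projection along this direction.  The parameter [s] leaves
   room for a generic choice. *)
Lemma nonedge_family k i j : (forall i, exists u, exposedat k u i) ->
  i != j -> ~ edge k i j ->
  exists rho, ~ colinear (k i - k j) rho /\
    near0 (fun s => forall u, dot (k i - k j + s *: rho) u = 0 ->
       ~ exposedat k u i /\ ~ exposedat k u j).
Proof.
move=> kx ij ne.
have [c [lam [f [/andP[c0 c1] /andP[l0 l1] fi fj h]]]] := nonedge_combination kx ij ne.
exists (k f - (k i - c *: (k i - k j))); split.
  move=> [t tE]; apply: (exposed_notcolinear kx ij fi fj).
  exists (c - t); apply/eqP; rewrite -subr_eq0; apply/eqP/dot_eq0l => u.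
  have := congr1 (fun x => dot x u) tE; rewrite !dotE; nra.
(* Let [y] be the value at the point of the segment. If [k i] has the maximal value [a],
   orthogonality gives [a - y = c * s * (y - z)], which is less than [lam * (a - z)] for [s < lam].
   If [k j] has the maximal value [b], it gives [b - y = (1 - c) * s * (z - y)], impossible for
   [s < 1] since [z < b]. *)
apply: (near0_sub _ (near0_lt l0)) => s s0 sl u; rewrite !dotE => wu.
split=> H.
  have := h u _ (exposedat_max H); have := H f fi; rewrite !dotE.
  set a := dot (k i) u in wu *; set b := dot (k j) u in wu *; set z := dot (k f) u in wu *.
  move=> za h1.
  have r0 : 0 < c * s by rewrite mulr_gt0.
  have r1 : c * s < lam by nra.
  pose r := c * s; pose A := a - z; pose Y := a - c * (a - b) - z.
  have P : 0 < (lam * (1 + r) - r) * A by rewrite mulr_gt0 /r /A ?subr_gt0 //; nra.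
  have eY : a - b = s * Y by move: wu; rewrite /Y; nra.
  have eA : (1 + r) * Y = A.
    by rewrite /A mulrDl mul1r /r -mulrA -eY /Y; ring.
  have h2 : lam * A <= r * Y by rewrite /r -mulrA -eY /A; move: h1; lra.
  have : lam * A * (1 + r) <= r * Y * (1 + r) by rewrite ler_wpM2r // /r; lra.
  have := congr1 ( *%R r) eA; nra.
have := h u _ (exposedat_max H); have := H f fj; rewrite !dotE.
set a := dot (k i) u in wu *; set b := dot (k j) u in wu *; set z := dot (k f) u in wu *.
move=> zb h1.
have := mulr_gt0 l0; move=> /(_ (b - z)); rewrite subr_gt0 => /(_ zb) h2.
pose y := a - c * (a - b).
have yb : y < b by rewrite /y; lra.
have e1 : a - b = - (s * (z - y)) by rewrite /y; lra.
have e2 : b - y = (1 - c) * s * (z - y).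
  have -> : b - y = - ((1 - c) * (a - b)) by rewrite /y; ring.
  rewrite e1; ring.
have r0 : 0 < (1 - c) * s by rewrite mulr_gt0 // subr_gt0.
have r1 : (1 - c) * s < 1 by nra.
nra.
Qed.

(** A direction [u] exposing [k i] is turned towards [n]; the first vertex that catches up with
    [k i] spans an edge with it. *)
Lemma edge_increasing k i (n : 'cV[R]_d.+1) : (forall i, exists u, exposedat k u i) ->
  (exists j, dot (k i) n < dot (k j) n) ->
  exists j, edge k i j /\ dot (k i) n < dot (k j) n.
Proof.
move=> kx [j0 hj0]; have [u0 hu0] := kx i.
(* [dot (X j l) u] vanishes exactly when [j] and [l] catch up simultaneously, so a generic [u]
   leaves a single first vertex. *)
pose X j l := dot (k l - k i) n *: (k i - k j) - dot (k j - k i) n *: (k i - k l).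
have [v hv] := generic_vector [seq X p.1 p.2 | p <- enum {: I * I}].
have : near0 (fun e => exposedat k (u0 + e *: v) i /\ forall j l, X j l != 0 -> dot (X j l) (u0 + e *: v) != 0).
  apply: near0_and; first exact: exposedat_near0.
  apply: near0_fin => j; apply: near0_fin => l; have [->|X0] := eqVneq (X j l) 0; first exact: near0T.
  have : near0 (fun e => dot (X j l) u0 + e * dot (X j l) v != 0).
    apply: near0_neq0; apply/orP; right; apply: hv => //.
    by apply/mapP; exists (j, l); rewrite ?mem_enum.
  by apply: near0_sub => e _ h _; rewrite !(dotDr, dotZr).
case/near0_ex => e _; move: (u0 + e *: v) => u [ui ug].
pose J := [pred j | dot (k i) n < dot (k j) n].
pose t j := dot (k i - k j) u / dot (k j - k i) n.
case: (@arg_minP _ _ _ j0 J t hj0) => j; rewrite inE => jJ jmin.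
have tE l : l \in J -> dot (k i - k l) u = t l * dot (k l - k i) n.
  by rewrite inE => lJ; rewrite /t divfK // gt_eqF // !dotE subr_gt0.
have ji : j != i by apply: contraTneq jJ => ->; rewrite ltxx.
have t0 : 0 < t j.
  by apply: divr_gt0; rewrite !(dotDl, dotNl) subr_gt0 //; apply: ui.
exists j; split=> //; exists (u + t j *: n); split.
  have := tE j; rewrite inE jJ !dotE => /(_ isT); lra.
move=> l li lj; rewrite !(dotDr, dotZr).
have [lJ|/negP] := boolP (l \in J).
  have h := tE l lJ; have tl := jmin l lJ; rewrite inE in lJ.
  suff tt : t j < t l.
    have : 0 < (t l - t j) * (dot (k l) n - dot (k i) n) by rewrite mulr_gt0 // subr_gt0.
    move: h; rewrite !(dotDl, dotNl); nra.
  rewrite lt_neqAle tl andbT; apply/negP => /eqP tjl.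
  have X0 : X j l != 0.
    apply/negP => /eqP E; apply: (exposed_notcolinear kx (i := i) (j := j) (l := l)) => //.
      by rewrite eq_sym.
    exists (dot (k l - k i) n / dot (k j - k i) n).
    have hn : dot (k j) n + - dot (k i) n != 0 by rewrite subr_eq0 gt_eqF.
    apply: (scalerI (a := dot (k j - k i) n)); first by rewrite !dotE.
    rewrite scalerA mulrC divfK ?dotE //; move/subr0_eq: E.
    rewrite !dotE => E; apply: oppr_inj; rewrite -!scalerN !opprB.
    by rewrite E.
  move/negP: (ug j l X0); apply; rewrite /X !dotE.
  have := h; have := tE j jJ; rewrite -tjl !dotE => -> ->; apply/eqP; ring.
rewrite inE => /negP; rewrite -leNgt => hl; have := ui l li; nra.
Qed.

End Polytope.

(** The upper envelope of the lines [p c + t * q c] is followed from [t = 0] to [t = 1]. At each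
    breakpoint the old and the new line are both maximal, so [phi] does not change. *)
Lemma upper_envelope (R : realFieldType) (I : finType) (T : Type) (P : pred I)
    (p q : I -> R) (phi : I -> T) :
  (forall t, 0 <= t <= 1 -> forall a b, P a -> P b ->
     (forall c, P c -> p c + t * q c <= p a + t * q a) ->
     (forall c, P c -> p c + t * q c <= p b + t * q b) -> phi a = phi b) ->
  forall i j, P i -> P j -> (forall c, P c -> p c <= p i) ->
  (forall c, P c -> p c + q c <= p j + q j) -> phi i = phi j.
Proof.
move=> hphi i j Pi Pj i0 j1.
suff H n i' t0 : (#|[pred f | P f & (q i' < q f)%R]| < n)%N -> P i' -> 0 <= t0 <= 1 ->
   (forall c, P c -> p c + t0 * q c <= p i' + t0 * q i') -> phi i' = phi j.
  apply: (H _ i 0 (ltnSn _)) => //; first by rewrite lexx ler01.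
  by move=> c Pc; rewrite !mul0r !addr0; apply: i0.
elim: n i' t0 => // n IH a t0 an Pa t01 a0.
have [qja|qaj] := leP (q j) (q a).
  apply: (hphi 1) => //; first by rewrite lexx ler01.
  - by move=> c /j1 h1; have := a0 j Pj; nra.
  - by move=> c; rewrite !mul1r; apply: j1.
pose J := [pred f | P f & q a < q f].
(* The parameter at which [f] overtakes [a]. The earliest such [f] replaces [a], and fewer lines are
   steeper than it. *)
pose t f := (p a - p f) / (q f - q a).
have jJ : J j by rewrite /= Pj.
case: (@arg_minP _ _ _ j J t jJ) => f /andP[Pf qf] fmin.
have tE l : J l -> p a - p l = t l * (q l - q a).
  by case/andP => _ lq; rewrite /t divfK // subr_eq0 gt_eqF.
have tf1 : t f <= 1.
  apply: (le_trans (fmin j jJ)); have := tE j jJ; have := j1 a Pa; nra.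
have t0f : t0 <= t f by have := tE f; rewrite /= Pf qf => /(_ isT); have := a0 f Pf; nra.
have af : p f + t f * q f = p a + t f * q a.
  by have := tE f; rewrite /= Pf qf => /(_ isT); lra.
have amax c : P c -> p c + t f * q c <= p a + t f * q a.
  move=> Pc; have [qc|qc] := leP (q c) (q a); first by have := a0 c Pc; nra.
  have Jc : J c by rewrite /= Pc.
  have := tE c Jc; have := fmin c Jc; nra.
have tf01 : 0 <= t f <= 1 by case/andP: t01 => ? ?; rewrite tf1 andbT; lra.
have -> : phi a = phi f by apply: (hphi (t f)) => // c Pc; rewrite af; apply: amax.
apply: (IH f (t f)) => //; last by move=> c Pc; rewrite af; apply: amax.
rewrite -ltnS; apply: (leq_trans _ an); rewrite ltnS; apply: proper_card.
apply/properP; split.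
  by apply/subsetP => x; rewrite !inE => /andP[-> /(lt_trans qf)].
by exists f; rewrite inE /= ?Pf ?qf ?ltxx.
Qed.

(** * Even maps on the vertices of a centrally symmetric polytope *)

(* [k] enumerates the vertices of a full-dimensional polytope that is symmetric about
   0.  By [conf_compat] and [conf_even], the value of [dot (g i) u] at a maximizer
   [i] of [u] is an odd piecewise linear function of [u], linear on normal cones. *)
Record conf (R : realFieldType) d (I : finType) (k g : I -> 'rV[R]_d) (o : I -> I) : Prop :=
  Conf {
    conf_exposed : forall i, exists u, exposedat k u i;
    conf_opp : forall i, k (o i) = - k i;
    conf_even : forall i, g (o i) = g i;
    conf_compat : forall u i j, maxat k u i -> maxat k u j -> dot (g i) u = dot (g j) u;
    conf_span : forall u, (forall i, dot (k i) u = 0) -> u = 0 }.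

Section Conf.
Context {R : realFieldType} {d : nat} {I : finType} {k g : I -> 'rV[R]_d.+1} {o : I -> I}.
Hypothesis C : conf k g o.

Lemma conf_inj : injective k.
Proof. exact: exposed_inj (conf_exposed C). Qed.

Lemma conf_oppK i : o (o i) = i.
Proof. by apply: conf_inj; rewrite !(conf_opp C) opprK. Qed.

Lemma conf_neq0 i : k i != 0.
Proof.
apply/negP => /eqP ki0; have [u hu] := conf_exposed C i.
have no j : j = i.
  apply/eqP; apply: contrapT => /negP ji; have := hu j ji.
  have oji : o j != i by apply: contra ji => /eqP E; rewrite -[j]conf_oppK E; apply/eqP/conf_inj; rewrite (conf_opp C) ki0 oppr0.
  have := hu (o j) oji; rewrite (conf_opp C) dotNl ki0 dot0l; lra.
have : const_mx 1 = 0 :> 'cV[R]_d.+1.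
  by apply: (conf_span C) => j; rewrite (no j) ki0 dot0l.
by move/colP/(_ 0); rewrite !mxE => /eqP; rewrite oner_eq0.
Qed.

Lemma conf_opp_neq i : o i != i.
Proof.
apply/negP => /eqP /(congr1 k); rewrite (conf_opp C) => E; move/negP: (conf_neq0 i); apply.
have : k i *+ 2 = 0 by rewrite mulr2n -{1}E addNr.
by move/eqP; rewrite -scaler_nat scaler_eq0 pnatr_eq0.
Qed.

Lemma maxat_opp u i : maxat k u i -> maxat k (- u) (o i).
Proof.
move=> h j; have := h (o j); rewrite !(conf_opp C) !dotNl !dotNr; lra.
Qed.

Lemma maxat_gt0 u i : u != 0 -> maxat k u i -> 0 < dot (k i) u.
Proof.
move=> u0 h; rewrite ltNge; apply: contra u0 => h0; apply/eqP/(conf_span C) => j.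
have := h j; have := h (o j); rewrite (conf_opp C) dotNl; lra.
Qed.

Lemma exists_maxat u (i0 : I) : exists i, maxat k u i.
Proof. by have [i [? _]] := exposed_maximizer u i0 conf_inj; exists i. Qed.

(** A generic functional is positive on exactly one vertex of each opposite pair. *)
Lemma exists_half (D : {set I}) : (forall i, i \in D -> o i \in D) ->
  exists D1 : {set I}, #|D| = (2 * #|D1|)%N /\ D = D1 :|: [set o i | i in D1].
Proof.
move=> oD; have [phi hphi] := generic_vector [seq k i | i <- enum I].
have kphi i : dot (k i) phi != 0.
  by apply: hphi (conf_neq0 i); apply/mapP; exists i; rewrite ?mem_enum.
pose D1 := [set i in D | 0 < dot (k i) phi].
have oinj : injective o by apply: can_inj conf_oppK.
have DE : D = D1 :|: [set o i | i in D1].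
  apply/setP => i; rewrite !inE; apply/idP/orP => [iD|].
    have := kphi i; rewrite neq_lt => /orP[h|h]; [right|left; by rewrite iD].
    by apply/imsetP; exists (o i); rewrite ?conf_oppK // inE oD //= (conf_opp C) dotNl oppr_gt0.
  by case=> [/andP[]//|/imsetP[j]]; rewrite inE => /andP[jD _ ->]; apply: oD.
exists D1; split=> //.
rewrite DE cardsU card_imset // mul2n addnn.
suff -> : D1 :&: [set o i | i in D1] = set0 by rewrite cards0 subn0.
apply/setP => i; rewrite !inE; apply/negP => /andP[/andP[_ h]] /imsetP[j].
rewrite inE => /andP[_ hj] E; move: h; rewrite E (conf_opp C) dotNl; lra.
Qed.

(** Opposite indices impose the same condition on [n], so only half of the elements of [D] count. *)
Lemma half_annihilator (D : {set I}) (x : I -> 'rV[R]_d.+1) :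
  (forall i, i \in D -> o i \in D) ->
  (forall i n, dot (x i) n = 0 -> dot (x (o i)) n = 0) -> (#|D| < 2 * d.+1)%N ->
  exists2 n : 'cV[R]_d.+1, n != 0 & forall i, i \in D -> dot (x i) n = 0.
Proof.
move=> /exists_half [D1 [cD1 DE]] ox cD.
have [|n n0 hn] := @exists_annihilator R d.+1 I D1 x; first by lia.
exists n => // i; rewrite DE inE => /orP[/hn//|/imsetP[j jD ->]].
by apply/ox/hn.
Qed.

Lemma conf_card : (2 * d.+1 <= #|I|)%N.
Proof.
rewrite leqNgt; apply/negP; rewrite -cardsT => h.
have [||n n0 hn] := @half_annihilator setT k _ _ h; first by [].
  by move=> i n; rewrite (conf_opp C) dotNl => ->; rewrite oppr0.
by move/eqP: n0; apply; apply: (conf_span C) => i; apply: hn.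
Qed.

(** If [v] is orthogonal to the edge, both ends stay maximal when the direction [u] of the edge is
    moved slightly along [v]; compatibility at [u] and at the moved direction gives
    [dot (g j - g i) v = 0]. *)
Lemma conf_edge i j : i != j -> edge k i j -> exists t, g j - g i = t *: (k j - k i).
Proof.
move=> ij [u [uij hu]]; apply: colinear_dot.
  by rewrite subr_eq0; apply: contra ij => /eqP/conf_inj->.
move=> v; rewrite !(dotDl, dotNl) => hv.
have mi : maxat k u i.
  move=> l; have [->//|li] := eqVneq l i; have [->|lj] := eqVneq l j; first by rewrite uij.
  exact/ltW/hu.
have : near0 (fun e => maxat k (u + e *: v) i).
  have : near0 (fun e => forall l, l != i -> l != j -> 0 < dot (k i - k l) u + e * dot (k i - k l) v).
    apply: near0_fin => l; have [->|li] := eqVneq l i; first exact: near0T.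
    have [->|lj] := eqVneq l j; first exact: near0T.
    have : 0 < dot (k i - k l) u by rewrite !(dotDl, dotNl) subr_gt0 hu.
    by move=> /(near0_pos (dot (k i - k l) v)); apply: near0_sub.
  apply: near0_sub => e _ h l; rewrite !(dotDr, dotZr).
  have [->//|li] := eqVneq l i; have [->|lj] := eqVneq l j; first by nra.
  by have := h l li lj; rewrite !(dotDl, dotNl); nra.
case/near0_ex => e e0 mi'.
have eqv w : dot (k i) w = dot (k j) w -> maxat k w i -> maxat k w j.
  by move=> E h l; rewrite -E.
have mj : maxat k u j by apply: eqv mi.
have mj' : maxat k (u + e *: v) j by apply: eqv mi'; rewrite !(dotDr, dotZr); nra.
have := conf_compat C mi mj; have := conf_compat C mi' mj'.
rewrite !(dotDr, dotZr) => h1 h2.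
have : e * (dot (g j) v - dot (g i) v) = 0 by lra.
by move/eqP; rewrite mulf_eq0 gt_eqF //= => /eqP; lra.
Qed.

(** Two edges would make [g j - g i] a multiple of both [k j - k i] and [k j + k i]. These are
    independent, since [k i] is not on the line through [k j] and [- k j]. *)
Lemma conf_nonedge i j : g i != g j -> ~ edge k i j \/ ~ edge k i (o j).
Proof.
move=> gij; apply: contrapT => /not_orP[/contrapT e1 /contrapT e2].
have ij : i != j by apply: contra gij => /eqP->.
have ioj : i != o j by apply: contra gij => /eqP->; rewrite (conf_even C).
have [t tE] := conf_edge ij e1; have [s sE] := conf_edge ioj e2.
rewrite (conf_even C) (conf_opp C) in sE.
have E : (t - s) *: k i = (t + s) *: k j.
  apply/eqP; rewrite -subr_eq0; apply/eqP/dot_eq0l => u.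
  have := congr1 (fun x => dot x u) tE; have := congr1 (fun x => dot x u) sE.
  rewrite !dotE; nra.
have [ts|ts] := eqVneq t s.
  move: E; rewrite ts subrr scale0r => /esym/eqP; rewrite scaler_eq0 (negbTE (conf_neq0 j)) orbF.
  rewrite -mulr2n -mulr_natr mulf_eq0 pnatr_eq0 orbF => /eqP s0; move/eqP: gij; apply.
  by apply/esym/eqP; rewrite -subr_eq0 tE ts s0 scale0r.
have kij : k i = ((t + s) / (t - s)) *: k j.
  apply: (scalerI (a := t - s)); first by rewrite subr_eq0.
  by rewrite E scalerA mulrC divfK // subr_eq0.
apply: (exposed_notcolinear (conf_exposed C) (i := j) (j := o j) (l := i)) => //.
  by rewrite eq_sym conf_opp_neq.
exists ((1 - (t + s) / (t - s)) / 2); rewrite (conf_opp C); apply/eqP; rewrite -subr_eq0.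
apply/eqP/dot_eq0l => u; have := congr1 (fun x => dot x u) kij; rewrite !dotE => ->; field.
by rewrite subr_eq0.
Qed.

(* If every [g i] has the same inner product with [e], then moving along [e]
   does not change the support function [u |-> dot (g i) u], [i] maximal at [u]. *)
Lemma conf_invariant e u i j : (forall i j, dot (g i - g j) e = 0) ->
  maxat k u i -> maxat k (u + e) j -> dot (g i) u = dot (g j) u.
Proof.
move=> he mi mj.
apply: (@upper_envelope R I _ predT (fun c => dot (k c) u) (fun c => dot (k c) e) (fun c => dot (g c) u)) => //.
- move=> t _ a b _ _ ha hb.
  have ma : maxat k (u + t *: e) a by move=> c; rewrite !(dotDr, dotZr); apply: ha.
  have mb : maxat k (u + t *: e) b by move=> c; rewrite !(dotDr, dotZr); apply: hb.
  have := conf_compat C ma mb; have := he a b; rewrite !(dotDr, dotZr, dotDl, dotNl); nra.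
- by move=> c _; have := mj c; rewrite !dotDr.
Qed.

(* If the level set lies in a hyperplane, each of its points has a neighbour on either
   side; distinct points have distinct neighbours, since the edges to a common
   neighbour [v] would all be parallel to the difference of [g] along them. *)
Lemma conf_class_bound i0 : (1 < d)%N ->
  (forall e, (forall i j, dot (g i - g j) e = 0) -> e = 0) ->
  (2 * d <= #|[set j | g j == g i0]|)%N -> (4 * d.+1 <= #|I|)%N.
Proof.
move=> d1 noA; set K := [set j | _] => cK.
have oK i : i \in K -> o i \in K by rewrite !inE (conf_even C).
have [[n [n0 hn]]|span] := pselect (exists n, n != 0 /\ forall i, i \in K -> dot (k i) n = 0).
  have [u un] := dot_neq0r n0.
  have up : exists j, 0 < dot (k j) n.
    have [j hj] := exists_maxat n i0; exists j; exact: maxat_gt0.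
  have nb : forall i, exists v, i \in K -> edge k i v /\ 0 < dot (k v) n.
    move=> i; have [iK|_] := boolP (i \in K); last by exists i.
    have [|v [near0 hv]] := @edge_increasing R d I k i n (conf_exposed C).
      by rewrite hn.
    by exists v => _; split=> //; rewrite -(hn i iK).
  have [f hf] := choice nb.
  have fK i : i \in K -> f i \notin K.
    by move=> iK; apply/negP => /hn E; have [_] := hf i iK; rewrite E ltxx.
  have finj : {in K &, injective f}.
    move=> a b aK bK fab; apply/eqP; apply: contrapT => /negP ab.
    have [ea _] := hf a aK; have [eb _] := hf b bK.
    have af : a != f a by apply: contraNneq (fK a aK) => <-.
    have bf : b != f b by apply: contraNneq (fK b bK) => <-.
    have [t tE] := conf_edge af ea; have [s sE] := conf_edge bf eb.
    have gab : g a = g b by move: aK bK; rewrite !inE => /eqP-> /eqP->.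
    rewrite -fab -gab in sE; rewrite -fab in bf.
    have t0 : t != 0.
      apply/negP => /eqP t0; move: (fK a aK); rewrite inE; apply/negP; rewrite negbK.
      move/eqP: tE; rewrite t0 scale0r subr_eq0 => /eqP->.
      by move: aK; rewrite inE.
    apply: (exposed_notcolinear (conf_exposed C) (i := f a) (j := b) (l := a)) => //.
      by rewrite eq_sym.
    exists (s / t); apply: (scalerI t0); rewrite scalerA mulrC divfK //.
    by apply: oppr_inj; rewrite -!scalerN !opprB -tE -sE.
  pose Pos := [set i | 0 < dot (k i) n]; pose Neg := [set o i | i in Pos].
  have cPos : (#|K| <= #|Pos|)%N.
    rewrite -(card_in_imset finj); apply: subset_leq_card.
    apply/subsetP => v /imsetP[i iK ->]; by rewrite inE; case: (hf i iK).
  have cNeg : #|Neg| = #|Pos| by apply: card_imset; apply: can_inj conf_oppK.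
  (* Three disjoint sets of at least [2 * d] elements each suffice, because [6 * d >= 4 * d.+1] for
     [d > 1]. *)
  have d1' : [disjoint K & Pos].
    rewrite disjoint_subset; apply/subsetP => i iK; rewrite !inE hn // ltxx //.
  have d2 : [disjoint K :|: Pos & Neg].
    rewrite disjoint_sym disjoint_subset; apply/subsetP => i /imsetP[j]; rewrite inE => jP ->.
    have jn : dot (k (o j)) n < 0 by rewrite (conf_opp C) dotNl oppr_lt0.
    rewrite 2!inE; apply/negP => /orP[/hn|]; first by move: jn => /[swap] ->; rewrite ltxx.
    by rewrite inE; lra.
  have : (#|K :|: Pos :|: Neg| <= #|I|)%N by rewrite -cardsT subset_leq_card // subsetT.
  by move: d1' d2; rewrite -!leq_card_setU => /eqP-> /eqP->; lia.
(* If the level set spans, then both it and its complement have at least [2 * d.+1] elements. For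
   the complement: the differences [g i - g i0] vanish on [K], so fewer elements outside would leave
   them all in a hyperplane, against [noA]. *)
have cK2 : (2 * d.+1 <= #|K|)%N.
  rewrite leqNgt; apply/negP => h; apply: span.
  have [||n n0 hn] := @half_annihilator K k _ _ h; last by exists n.
    by [].
  by move=> i n; rewrite (conf_opp C) dotNl => ->; rewrite oppr0.
have cK3 : (2 * d.+1 <= #|~: K|)%N.
  rewrite leqNgt; apply/negP => h.
  have [||e e0 he] := @half_annihilator (~: K) (fun i => g i - g i0) _ _ h.
  - by move=> i; rewrite !inE (conf_even C).
  - by move=> i n; rewrite (conf_even C).
  move/eqP: e0; apply; apply: noA.
  have he' i : dot (g i - g i0) e = 0.
    have [iK|] := boolP (i \in K); last by move=> h'; apply: he; rewrite inE.
    by move: iK; rewrite inE => /eqP->; rewrite subrr dot0l.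
  by move=> i j; have := he' i; have := he' j; rewrite !(dotDl, dotNl); lra.
by have := cardsC K; lia.
Qed.

(** For each nonzero [x] at most one member of the family is parallel to [x], as [w] and [rho] are
    independent. *)
Lemma generic_family (w rho : 'rV[R]_d.+1) (s : seq 'rV[R]_d.+1) : w != 0 -> ~ colinear w rho ->
  near0 (fun e => forall x, x \in s -> x != 0 -> ~ colinear (w + e *: rho) x).
Proof.
move=> w0 nc; apply: near0_seq => x _; have [->|x0] := eqVneq x 0; first exact: near0T.
suff : near0 (fun e => ~ colinear (w + e *: rho) x) by apply: near0_sub => e _ h _.
apply: near0_avoid => a b [t tE] [t' tE'].
have E : (t - t') *: w + (t * a - t' * b) *: rho = 0.
  apply/eqP; rewrite !scalerBl -!scalerA addrACA -opprD -!scalerDr -tE -tE'.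
  by rewrite subrr.
have t0 : t != 0 by apply: contra x0 => /eqP t0; rewrite tE t0 scale0r.
have r0 : t * a - t' * b = 0.
  apply/eqP; apply: contrapT => /negP r0; apply: nc; exists (- ((t - t') / (t * a - t' * b))).
  apply: (scalerI r0); rewrite scalerA mulrN mulrCA divff ?mulr1 // scaleNr.
  by apply/eqP; rewrite -subr_eq0 opprK addrC E.
move: E; rewrite r0 scale0r addr0 => /eqP; rewrite scaler_eq0 (negbTE w0) orbF subr_eq0 => /eqP tt.
by apply: (mulfI t0); apply/eqP; rewrite -subr_eq0 {2}tt r0.
Qed.

(** The vertices of the projection along [w] come from the vertices exposed by some [u] orthogonal
    to [w]. Every such [u] has a maximizer among them, so maxima over [J] are maxima over [I] and
    compatibility is inherited. *)
Lemma conf_quotient (w : 'rV[R]_d.+1) : w != 0 ->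
  (forall i j, i != j -> ~ colinear w (k i - k j)) ->
  exists (B : 'M[R]_(d.+1, d)) (J : finType) (f : J -> I) (oJ : J -> J),
    [/\ injective f, conf (fun a => k (f a) *m B) (fun a => g (f a) *m B) oJ,
        forall a, f (oJ a) = o (f a),
        forall i, (exists a, f a = i) <-> exists2 u, dot w u = 0 & exposedat k u i
     & [/\ forall u, dot w u = 0 -> exists u', u = B *m u',
         forall u, dot w u = 0 -> exists a, maxat k u (f a) &
         forall x : 'rV[R]_d.+1, x *m B = 0 -> colinear w x]].
Proof.
move=> w0 hw; have [B [wB B1 B2 B3]] := exists_quotient w0.
pose kB i := k i *m B.
pose S i := `[< exists2 u, dot w u = 0 & exposedat k u i >].
have SE i : S i <-> exists u', exposedat kB u' i.
  split=> [/asboolP [u /B1 [u' ->] h]|[u' h]].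
    by exists u' => j ji; rewrite !dot_mul; apply: h.
  apply/asboolP; exists (B *m u'); first by rewrite -dot_mul wB dot0l.
  by move=> j ji; rewrite -!dot_mul; apply: h.
have kBi : injective kB.
  move=> i j E; apply/eqP; apply: contrapT => /negP ij; apply: (hw i j ij); apply: B3.
  by rewrite mulmxBl; move: E; rewrite /kB => ->; rewrite subrr.
have oS i : S i -> S (o i).
  move=> /asboolP [u wu h]; apply/asboolP; exists (- u); first by rewrite dotNr wu oppr0.
  move=> j ji; have := h (o j); rewrite !(conf_opp C) !dotNr !dotNl => h'.
  have : o j != i by apply: contra ji => /eqP<-; rewrite conf_oppK.
  by move/h'; lra.
have Smax u : dot w u = 0 -> forall i0 : I, exists i, S i /\ maxat k u i.
  move=> /B1 [u' ->] i0; have [i [mi hi]] := exposed_maximizer u' i0 kBi.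
  exists i; split; first exact/SE.
  by move=> j; rewrite -!dot_mul; apply: mi.
have i0 : I.
  have : (0 < #|I|)%N by apply: leq_trans conf_card; lia.
  by case/card_gt0P/sigW.
pose oJ (a : {i | S i}) : {i | S i} := exist _ (o (sval a)) (oS _ (svalP a)).
exists B, {i | S i}, sval, oJ; split=> //.
- exact: val_inj.
- split.
  + move=> a; have [u hu] := (SE (sval a)).1 (svalP a); exists u => b ba.
    by apply: hu; apply: contra ba => /eqP/val_inj->.
  + by move=> a; rewrite /= (conf_opp C) mulNmx.
  + by move=> a; rewrite /= (conf_even C).
  + move=> u a b ha hb.
    have up (c : {i | S i}) : maxat (fun a : {i | S i} => k (sval a) *m B) u c -> maxat k (B *m u) (sval c).
      move=> hc j; have [|i [Si mi]] := Smax (B *m u) _ i0; first by rewrite -dot_mul wB dot0l.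
      by apply: (le_trans (mi j)); have := hc (exist _ i Si); rewrite /= !dot_mul.
    by rewrite !dot_mul; apply: (conf_compat C); apply: up.
  + move=> u hu; apply: B2; apply: (conf_span C).
    have [|i [Si mi]] := Smax (B *m u) _ i0; first by rewrite -dot_mul wB dot0l.
    have E := hu (exist _ i Si); rewrite /= dot_mul in E.
    by move=> j; have := mi j; have := mi (o j); rewrite E (conf_opp C) dotNl; lra.
- move=> i; split=> [[a <-]|h]; first exact/asboolP/(svalP a).
  by have Si : S i by [apply/asboolP]; exists (exist _ i Si).
- split=> // u /Smax /(_ i0) [i [Si mi]]; by exists (exist _ i Si).
Qed.

End Conf.

Lemma card_conf (R : realFieldType) d (I : finType) (k g : I -> 'rV[R]_d) o :
  conf k g o -> (2 * d <= #|I|)%N.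
Proof. by case: d k g => [|d] k g // C; exact: conf_card C. Qed.

(** * Projection along a generic direction *)

Definition nonconstant (I : Type) (T : eqType) (g : I -> T) := exists i j, g i != g j.

Definition min_vertices d := (if d == 2 then 6 else 4 * d)%N.

Definition vertex_bound (R : realFieldType) d := forall (I : finType) (k g : I -> 'rV[R]_d) o,
  conf k g o -> nonconstant g -> (min_vertices d <= #|I|)%N.

Section Step.
Context {R : realFieldType} {d : nat} {I : finType} {k g : I -> 'rV[R]_d.+1} {o : I -> I}.
Hypothesis C : conf k g o.

(** The second clause keeps the projection along [w] injective on the vertices, the third keeps
    distinct values of [g] distinct. *)
Definition generic_direction (w : 'rV[R]_d.+1) := [/\ w != 0,
  forall i j, i != j -> ~ colinear w (k i - k j) &
  forall i j, g i != g j -> ~ colinear w (g i - g j)].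

(** The vertices that remain vertices after projection along [w]. *)
Definition survivors (w : 'rV[R]_d.+1) : {set I} :=
  [set i | `[< exists2 u, dot w u = 0 & exposedat k u i >]].

Lemma generic_direction_family (w rho : 'rV[R]_d.+1) : w != 0 -> ~ colinear w rho ->
  near0 (fun e => generic_direction (w + e *: rho)).
Proof.
move=> w0 nc.
have := generic_family [seq k p.1 - k p.2 | p <- enum {: I * I}] w0 nc.
have := generic_family [seq g p.1 - g p.2 | p <- enum {: I * I}] w0 nc.
move=> h1 h2; apply: (near0_sub _ (near0_and h1 h2)) => e e0 {h1 h2} [h1 h2]; split.
- apply/negP => /eqP E; apply: nc; exists (- e^-1).
  have en0 : e != 0 by rewrite gt_eqF.
  apply: (scalerI en0); rewrite scalerA mulrN divff // scaleN1r.
  by apply/eqP; rewrite -subr_eq0 opprK addrC E.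
- move=> i j ij; apply: h2; first by apply/mapP; exists (i, j); rewrite ?mem_enum.
  by rewrite subr_eq0; apply: contra ij => /eqP/(conf_inj C)->.
- move=> i j gij; apply: h1; first by apply/mapP; exists (i, j); rewrite ?mem_enum.
  by rewrite subr_eq0.
Qed.

Lemma survivorsP w i : reflect (exists2 u, dot w u = 0 & exposedat k u i) (i \in survivors w).
Proof. by rewrite inE; exact: asboolP. Qed.

Lemma survivors_opp w i : i \in survivors w -> o i \in survivors w.
Proof.
move=> /survivorsP [u wu h]; apply/survivorsP; exists (- u); first by rewrite dotNr wu oppr0.
move=> j ji; have := h (o j); rewrite !(conf_opp C) !dotNr !dotNl => h'.
have : o j != i by apply: contra ji => /eqP<-; rewrite (conf_oppK C).
by move/h'; lra.
Qed.

Lemma survivors_opp_notin w i : i \notin survivors w -> o i \notin survivors w.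
Proof. by apply: contra => /survivors_opp; rewrite (conf_oppK C). Qed.

Lemma card_subset_notin (A B : {set I}) : [disjoint A & B] -> (#|A| + #|B| <= #|I|)%N.
Proof. by rewrite -leq_card_setU => /eqP<-; rewrite -cardsT subset_leq_card ?subsetT. Qed.

Lemma survivors_bound4 w i j : i \notin survivors w -> j \notin survivors w ->
  j != i -> j != o i -> (#|survivors w| + 4 <= #|I|)%N.
Proof.
move=> iS jS ji joi.
have h3 : o j != i by apply: contra joi => /eqP<-; rewrite (conf_oppK C).
have h4 : o j != o i.
  by apply: contra ji => /eqP E; rewrite -(conf_oppK C j) E (conf_oppK C).
have u4 : uniq [:: i; o i; j; o j].
  rewrite /= !inE !negb_or !(eq_sym i) (eq_sym (o i) j) (eq_sym (o i) (o j)).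
  by rewrite (eq_sym j (o j)) !(conf_opp_neq C) ji joi h3 h4.
have E : #|[set x in [:: i; o i; j; o j]]| = 4%N by rewrite cardsE; exact/card_uniqP.
rewrite -E; apply: card_subset_notin; rewrite disjoint_sym disjoint_subset.
apply/subsetP => x; rewrite inE mem_seq4 => xE.
suff : x \notin survivors w by [].
by case/or4P: xE => /eqP-> //; apply: survivors_opp_notin.
Qed.

Lemma plane_colinear (x y : 'rV[R]_2) u : u != 0 -> x != 0 -> dot x u = 0 -> dot y u = 0 ->
  colinear x y.
Proof.
move=> u0 x0 xu yu.
have D (z : 'rV[R]_2) v : dot z v = z 0 0 * v 0 0 + z 0 1 * v 1 0.
  by rewrite /dot mxE !big_ord_recl big_ord0 addr0; congr (_ * _ + _ * _); congr (_ _ _); apply: val_inj.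
rewrite !D in xu yu.
apply: colinear_dot => // v; rewrite !D => xv.
have [u00|u00] := eqVneq (u 0 0) 0.
  have u1 : u 1 0 != 0.
    apply: contra u0 => /eqP u1; apply/eqP/colP => i; rewrite mxE.
    by case: (unliftP 0 i) => [j ->|->//]; rewrite (ord1 j) -[RHS]u1; congr (u _ _); apply: val_inj.
  have x1 : x 0 1 = 0.
    by move: xu => /eqP; rewrite u00 mulr0 add0r mulf_eq0 (negbTE u1) orbF => /eqP.
  have y1 : y 0 1 = 0.
    by move: yu => /eqP; rewrite u00 mulr0 add0r mulf_eq0 (negbTE u1) orbF => /eqP.
  have x00 : x 0 0 != 0.
    apply: contra x0 => /eqP x00; apply/eqP/rowP => i; rewrite mxE.
    by case: (unliftP 0 i) => [j ->|->//]; rewrite (ord1 j) -[RHS]x1; congr (x _ _); apply: val_inj.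
  move: xv => /eqP; rewrite x1 y1 !mul0r !addr0 mulf_eq0 (negbTE x00) /= => /eqP->.
  by rewrite mulr0.
have ex : x 0 0 = - (x 0 1 * u 1 0 / u 0 0).
  by apply: (mulIf u00); rewrite mulNr divfK //; lra.
have ey : y 0 0 = - (y 0 1 * u 1 0 / u 0 0).
  by apply: (mulIf u00); rewrite mulNr divfK //; lra.
have x1 : x 0 1 != 0.
  apply: contra x0 => /eqP x1; apply/eqP/rowP => i; rewrite mxE.
  case: (unliftP 0 i) => [j ->|->]; last by rewrite ex x1 !mul0r oppr0.
  by rewrite (ord1 j) -[RHS]x1; congr (x _ _); apply: val_inj.
have : x 0 1 * (v 1 0 - u 1 0 / u 0 0 * v 0 0) = 0.
  by rewrite -[RHS]xv ex; ring.
move/eqP; rewrite mulf_eq0 (negbTE x1) /= subr_eq0 => /eqP ->.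
by rewrite ey; ring.
Qed.

(** The survivors are counted in the projection. The last clause expresses that for a polygon a
    supporting line contains at most two vertices. *)
Lemma survivors_conf w : generic_direction w ->
  [/\ (2 * d <= #|survivors w|)%N,
      (exists i j, [/\ i \in survivors w, j \in survivors w & g i != g j]) ->
        vertex_bound R d -> (min_vertices d <= #|survivors w|)%N,
      forall u, dot w u = 0 -> exists2 i, i \in survivors w & maxat k u i
    & forall u, d = 2 -> u != 0 -> dot w u = 0 ->
        (#|[set i in survivors w | `[<maxat k u i>]]| <= 2)%N].
Proof.
move=> [w0 hk hg].
have [B [J [f [oJ [fi CJ foJ fS [B1 B2 B3]]]]]] := conf_quotient C w0 hk.
have SE : survivors w = [set f a | a in setT].
  apply/setP => i; apply/survivorsP/imsetP => [/fS [a <-]|[a _ ->]]; first by exists a.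
  by apply/fS; exists a.
have cS : #|survivors w| = #|J| by rewrite SE card_imset // cardsT.
split.
- by rewrite cS; exact: card_conf CJ.
- move=> [i [j [iS jS gij]]] /(_ J _ _ _ CJ); rewrite cS; apply.
  move: iS jS; rewrite SE => /imsetP [a _ ia] /imsetP [b _ jb]; exists a, b.
  rewrite -ia -jb -subr_eq0 -mulmxBl; apply/negP => /eqP /B3 h; exact: (hg _ _ gij).
- by move=> u /B2 [a ma]; exists (f a) => //; rewrite SE; apply/imsetP; exists a.
- move=> u d2 u0 wu; rewrite leqNgt; apply/negP => /card_gt2P [x [y [z [[]]]]].
  have [u' uE] := B1 u wu.
  have imf t : t \in [set i in survivors w | `[<maxat k u i>]] ->
      exists2 a, f a = t & maxat k u t.
    rewrite inE SE => /andP[/imsetP [a _ ->] /asboolP h]; by exists a.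
  move=> /imf [a ax mx] /imf [b bx my] /imf [c cx mz] [xy yz zx].
  have ab : a != b by apply: contra xy => /eqP E; rewrite -ax -bx E.
  have bc : b != c by apply: contra yz => /eqP E; rewrite -bx -cx E.
  have ca : c != a by apply: contra zx => /eqP E; rewrite -ax -cx E.
  have eqm s t : maxat k u s -> maxat k u t -> dot (k s) u = dot (k t) u.
    by move=> hs ht; apply/eqP; rewrite eq_le hs ht.
  have cb : c != b by rewrite eq_sym.
  apply: (exposed_notcolinear (conf_exposed CJ) (i := a) (j := b) (l := c)) => //.
  have u'0 : u' != 0 by apply: contra u0 => /eqP E; rewrite uE E mulmx0.
  have d1 : dot (k (f b) *m B - k (f a) *m B) u' = 0.
    by rewrite -mulmxBl dot_mul -uE dotDl dotNl ax bx (eqm _ _ my mx) subrr.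
  have d2' : dot (k (f c) *m B - k (f a) *m B) u' = 0.
    by rewrite -mulmxBl dot_mul -uE dotDl dotNl ax cx (eqm _ _ mz mx) subrr.
  have n0 : k (f b) *m B - k (f a) *m B != 0.
    apply/negP; rewrite subr_eq0 => /eqP h; move/negP: ab; apply; apply/eqP.
    by apply: (exposed_inj (conf_exposed CJ)).
  by clear -d1 d2' n0 u'0 d2; subst d; apply: plane_colinear d2'.
Qed.

Lemma conf_nonempty : exists i : I, true.
Proof.
have : (0 < #|I|)%N by apply: leq_trans (conf_card C); lia.
by case/card_gt0P => i _; exists i.
Qed.

Lemma nonedge_direction i j (e : 'cV[R]_d.+1) : i != j -> ~ edge k i j ->
  exists w, [/\ generic_direction w, i \notin survivors w, j \notin survivors w &
    dot (k i - k j) e != 0 -> dot w e != 0].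
Proof.
move=> ij ne; have [rho [nc hr]] := nonedge_family (conf_exposed C) ij ne.
have w0 : k i - k j != 0 by rewrite subr_eq0; apply: contra ij => /eqP/(conf_inj C)->.
have he : near0 (fun s => dot (k i - k j) e != 0 -> dot (k i - k j + s *: rho) e != 0).
  have [_|h] := eqVneq (dot (k i - k j) e) 0; first exact: near0T.
  have : near0 (fun s => dot (k i - k j) e + s * dot rho e != 0) by apply: near0_neq0; rewrite h.
  by apply: near0_sub => s _ ? _; rewrite [dot _ _]dotDl dotZl.
have [s _ [H1 [H2 H3]]] := near0_ex (near0_and (generic_direction_family w0 nc) (near0_and hr he)).
exists (k i - k j + s *: rho); split=> //.
- by apply/survivorsP => -[u /H2 []].
- by apply/survivorsP => -[u /H2 []].
Qed.

(* The projection along [w] stays nonconstant as soon as [e] is not orthogonal to [w]. *)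
Lemma invariant_bound e : e != 0 -> (forall i j, dot (g i - g j) e = 0) -> nonconstant g ->
  vertex_bound R d -> (min_vertices d + 4 <= #|I|)%N.
Proof.
move=> e0 he [i1 [j1 gij1]] IH.
have [i mi] := exists_maxat C e i1.
have hpos := maxat_gt0 C e0 mi.
have [j gij] : exists j, g i != g j.
  have [E|] := eqVneq (g i) (g i1); last by exists i1.
  by exists j1; rewrite E.
(* If [k j'] has the same height along [e] as [k i], its opposite is taken instead. An edge from
   [k i] to it would make [g j' - g i], which is orthogonal to [e], a multiple of a vector that is
   not, forcing [g j' = g i]. *)
have key j' : g i != g j' -> ~ edge k i j' ->
    exists j, [/\ g i != g j, ~ edge k i j & dot (k i - k j) e != 0].
  move=> gj ne; have [E|h] := eqVneq (dot (k i - k j') e) 0; last by exists j'.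
  exists (o j'); split; first by rewrite (conf_even C).
    move=> ed; have ioj : i != o j' by apply: contra gj => /eqP->; rewrite (conf_even C).
    have [t tE] := conf_edge C ioj ed; rewrite (conf_even C) (conf_opp C) in tE.
    have := he j' i; rewrite tE dotZl; move: E; rewrite !(dotDl, dotNl) => E h.
    have t0 : t = 0.
      have : t * (2 * dot (k i) e) = 0 by rewrite -[RHS]oppr0 -[in RHS]h; nra.
      by move/eqP; rewrite mulf_eq0 [_ * dot _ _ == 0]gt_eqF ?orbF; [move/eqP|lra].
    by move/eqP: tE; rewrite t0 scale0r subr_eq0 eq_sym (negbTE gj).
  by rewrite (conf_opp C); move: E; rewrite !(dotDl, dotNl) => E; apply/negP => /eqP; lra.
have [j' [gij' ne dj]] : exists j, [/\ g i != g j, ~ edge k i j & dot (k i - k j) e != 0].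
  by case: (conf_nonedge C gij) => [/key|h]; [apply|apply: key h; rewrite (conf_even C)].
have ij : i != j' by apply: contra gij' => /eqP->.
have [w [gw iS jS /(_ dj) we]] := nonedge_direction e ij ne.
have c4 : (#|survivors w| + 4 <= #|I|)%N.
  apply: survivors_bound4 iS jS _ _; first by rewrite eq_sym.
  by apply: contra gij' => /eqP->; rewrite (conf_even C).
apply: leq_trans c4; rewrite leq_add2r.
have [_ h2 h3 _] := survivors_conf gw; apply: h2 => //.
apply: contrapT => no.
have gS a b : a \in survivors w -> b \in survivors w -> g a = g b.
  by move=> aS bS; apply/eqP; apply: contrapT => /negP ab; apply: no; exists a, b.
have [a aS _] := h3 0 (dot0r w).
have allg x : g x = g a.
  have [u hu] := conf_exposed C x.
  apply/eqP; rewrite -subr_eq0; apply/eqP; apply: (@eq_open _ _ _ u) => v.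
  apply: (near0_sub _ (exposedat_near0 v hu)) => s _ /exposedat_max.
  set u1 := u + s *: v => mx.
  (* Moving [u1] along [e] into the orthogonal complement of [w] reaches a survivor, and by
     [conf_invariant] the value of [g] is unaffected. Hence [g] constant on the survivors would be
     constant everywhere. *)
  pose t := - (dot w u1 / dot w e).
  have wt : dot w (u1 + t *: e) = 0 by rewrite dotDr dotZr /t mulNr divfK // subrr.
  have [b bS mb] := h3 _ wt.
  have he' p q : dot (g p - g q) (t *: e) = 0 by rewrite dotZr he mulr0.
  by rewrite dotDl dotNl (conf_invariant C he' mx mb) (gS b a bS aS) subrr.
by move: gij; rewrite !allg eqxx.
Qed.

Lemma step_bound : (2 < d)%N -> nonconstant g -> vertex_bound R d -> (4 * d.+1 <= #|I|)%N.
Proof.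
move=> d2 nc IH.
have minE : min_vertices d = (4 * d)%N by rewrite /min_vertices; case: eqP => //; lia.
have [[e [e0 he]]|noA] := pselect (exists e, e != 0 /\ forall i j, dot (g i - g j) e = 0).
  have := invariant_bound e0 he nc IH; rewrite minE; lia.
have {}noA e : (forall i j, dot (g i - g j) e = 0) -> e = 0.
  by move=> he; apply/eqP; apply: contrapT => /negP e0; apply: noA; exists e.
have [i [j gij]] := nc.
have [j' [gij' ne]] : exists j, g i != g j /\ ~ edge k i j.
  case: (conf_nonedge C gij) => h; first by exists j.
  by exists (o j); rewrite (conf_even C).
have ij : i != j' by apply: contra gij' => /eqP->.
have [w [gw iS jS _]] := nonedge_direction 0 ij ne.
have c4 : (#|survivors w| + 4 <= #|I|)%N.
  apply: survivors_bound4 iS jS _ _; first by rewrite eq_sym.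
  by apply: contra gij' => /eqP->; rewrite (conf_even C).
have [h1 h2 h3 _] := survivors_conf gw.
have [hn|no] := pselect (exists i j, [/\ i \in survivors w, j \in survivors w & g i != g j]).
  by have := h2 hn IH; rewrite minE; lia.
(* All survivors lie in one level set, which thus has at least the [2 * d] elements of a symmetric
   polytope in dimension [d]. *)
have [a aS _] := h3 0 (dot0r w).
apply: (conf_class_bound C (i0 := a)) => //; first by lia.
apply: (leq_trans h1); apply: subset_leq_card; apply/subsetP => b bS; rewrite inE.
by apply: contrapT => /negP ab; apply: no; exists b, a.
Qed.

End Step.

(** The projection to a line has at least 2 vertices, and 4 are destroyed. *)
Lemma vertex_bound2 (R : realFieldType) : vertex_bound R 2%N.
Proof.
move=> I k g o C [i [j gij]]; rewrite /min_vertices /=.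
have [j' [gij' ne]] : exists j, g i != g j /\ ~ edge k i j.
  case: (conf_nonedge C gij) => h; first by exists j.
  by exists (o j); rewrite (conf_even C).
have ij : i != j' by apply: contra gij' => /eqP->.
have [w [gw iS jS _]] := nonedge_direction C 0 ij ne.
have c4 : (#|survivors (k := k) w| + 4 <= #|I|)%N.
  apply: (survivors_bound4 C iS jS); first by rewrite eq_sym.
  by apply: contra gij' => /eqP->; rewrite (conf_even C).
by have [h1 _ _ _] := survivors_conf C gw; apply: leq_trans c4; rewrite (leq_add2r 4 2).
Qed.

(** * Faces, and the three-dimensional case *)

Section Face.
Context {R : realFieldType} {d : nat} {I : finType} {k g : I -> 'rV[R]_d.+1} {o : I -> I}.
Hypothesis C : conf k g o.

Definition face u : {set I} := [set i | `[<maxat k u i>]].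

Lemma faceP u i : reflect (maxat k u i) (i \in face u).
Proof. by rewrite inE; exact: asboolP. Qed.

Lemma maxat_eq u i j : maxat k u i -> maxat k u j -> dot (k i) u = dot (k j) u.
Proof. by move=> hi hj; apply/eqP; rewrite eq_le hi hj. Qed.

Lemma maxat_scale s u i : 0 < s -> maxat k u i -> maxat k (s *: u) i.
Proof. by move=> s0 h j; rewrite !dotZr ler_pM2l. Qed.

Lemma exposed_separated i :
  exists u, exposedat k u i /\ forall a b, a != b -> dot (k a) u != dot (k b) u.
Proof.
have [u hu] := conf_exposed C i; have [v hv] := generic_injective (conf_inj C).
have : near0 (fun s => exposedat k (u + s *: v) i /\ forall p : I * I, p.1 != p.2 -> dot (k p.1) (u + s *: v) != dot (k p.2) (u + s *: v)).
  apply: near0_and; first exact: exposedat_near0.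
  apply: near0_fin => -[a b] /=; have [_|ab] := eqVneq a b; first exact: near0T.
  have : near0 (fun s => dot (k a - k b) u + s * dot (k a - k b) v != 0).
    by apply: near0_neq0; apply/orP; right; rewrite dotDl dotNl subr_eq0 hv.
  apply: near0_sub => s _ h _; rewrite -subr_eq0 -dotNl -dotDl dotDr dotZr //.
by case/near0_ex => s _ [h1 h2]; exists (u + s *: v); split=> // a b; apply: (h2 (a, b)).
Qed.

(* The maximizers of a generic [v] and of [- v] on the face both carry the value of
   [g] that belongs to [v]. *)
Lemma face_class e i : (forall i j, dot (g i - g j) e = 0) -> nonconstant g ->
  exists a b, [/\ a \in face e, b \in face e, a != b, g a = g i & g b = g i].
Proof.
move=> he nc.
(* The maximizer of [u] on the face is exposed by [e + s *: u], up to scaling [u] moved along [e];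
   this does not change the value of [g]. *)
have top u j : exposedat k u j -> (forall a b, a != b -> dot (k a) u != dot (k b) u) ->
    exists a, [/\ maxat k e a, g a = g j & forall c, maxat k e c -> c != a -> dot (k c) u < dot (k a) u].
  move=> hu sep; have [a [ma /near0_ex [s s0 ha]]] := exposed_maximizer_generic e j sep.
  exists a; split=> //.
    apply/esym/eqP; rewrite -subr_eq0; apply/eqP; apply: (@eq_open _ _ _ u) => v.
    have h1 := exposedat_near0 (s *: v) ha; have h2 := exposedat_near0 v hu.
    apply: (near0_sub _ (near0_and h1 h2)) => r _ {h1 h2} [h1 h2].
    have mx : maxat k (u + r *: v + s^-1 *: e) a.
      have -> : u + r *: v + s^-1 *: e = s^-1 *: (e + s *: u + r *: (s *: v)).
        rewrite !scalerDr !scalerA mulVf ?gt_eqF // scale1r.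
        by rewrite mulrCA mulVf ?gt_eqF // mulr1 addrC addrA.
      by apply: maxat_scale; [rewrite invr_gt0|exact: exposedat_max].
    have he' p q : dot (g p - g q) (s^-1 *: e) = 0 by rewrite dotZr he mulr0.
    by rewrite dotDl dotNl (conf_invariant C he' (exposedat_max h2) mx) subrr.
  move=> c mc ca; have := ha c ca; rewrite !dotDr !dotZr (maxat_eq mc ma) ltrD2l.
  by rewrite ltr_pM2l.
have bot u j : exposedat k u j -> (forall a b, a != b -> dot (k a) u != dot (k b) u) ->
    exists b, [/\ maxat k e b, g b = g j & forall c, maxat k e c -> c != b -> dot (k b) u < dot (k c) u].
  move=> hu sep; have [||b [mb gb hb]] := top (- u) (o j).
  - move=> c cj; rewrite (conf_opp C) !dotNr dotNl opprK.
    have : o c != j by apply: contra cj => /eqP<-; rewrite (conf_oppK C).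
    by move/hu; rewrite (conf_opp C) dotNl; lra.
  - by move=> x y /sep; rewrite !dotNr; apply: contra => /eqP/oppr_inj->.
  exists b; split=> //; first by rewrite gb (conf_even C).
  by move=> c mc cb; have := hb c mc cb; rewrite !dotNr ltrN2.
have [u [hu sep]] := exposed_separated i.
have [a [ma ga ha]] := top u i hu sep; have [b [mb gb hb]] := bot u i hu sep.
exists a, b; split=> //; try exact/faceP.
(* If the maximizer and the minimizer on the face coincide, the face is a single vertex, and [top]
   makes [g] constant. *)
apply/negP => /eqP ab; subst b.
have [i1 [j1]] := nc; suff allg j : g j = g a by rewrite !allg eqxx.
have [v [hv sepv]] := exposed_separated j; have [c [mc gc hc]] := top v j hv sepv.
rewrite -gc; have [->//|ca] := eqVneq c a.
by have := lt_trans (ha c mc ca) (hb c mc ca); rewrite ltxx.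
Qed.

(** With two values only, all differences of [g] are multiples of [c = g i - g j], so directions
    with the same inner product with [c] have the same value of [g] in the sense of
    [conf_invariant]. Scaling a direction of [j], or of its opposite if the factor is negative, to
    match a direction [u] of [i] gives [dot c u = 0]. *)
Lemma three_classes : nonconstant g -> exists i j l, [/\ g i != g j, g j != g l & g l != g i].
Proof.
move=> [i [j gij]]; apply: contrapT => no.
have two l : g l = g i \/ g l = g j.
  have [->|li] := eqVneq (g l) (g i); first by left.
  have [->|lj] := eqVneq (g l) (g j); first by right.
  by case: no; exists i, j, l; rewrite gij li eq_sym lj.
pose c := g i - g j.
have c0 : c != 0 by rewrite subr_eq0.
have inv u u' p q : dot c (u' - u) = 0 -> maxat k u p -> maxat k u' q -> dot (g p) u = dot (g q) u.
  move=> cu mp mq; apply: (conf_invariant C (e := u' - u)) => //; last by rewrite addrC subrK.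
  by move=> x y; case: (two x) => ->; case: (two y) => ->;
    rewrite ?subrr ?dot0l // -[g j - g i]opprB dotNl -/c cu oppr0.
have expo p : exists u, maxat k u p /\ dot c u != 0.
  have [u hu] := conf_exposed C p; have [v hv] := dot_neq0l c0.
  have := exposedat_near0 v hu; have : near0 (fun s => dot c u + s * dot c v != 0).
    by apply: near0_neq0; rewrite (gt_eqF hv) orbT.
  move=> h1 h2; have [s _ [h3 h4]] := near0_ex (near0_and h1 h2).
  by exists (u + s *: v); split; [exact: exposedat_max|rewrite dotDr dotZr].
have [u [mu cu]] := expo i; have [u' [mu' cu']] := expo j.
pose m := dot c u / dot c u'.
have fin q : g q = g j -> maxat k (m *: u') q -> False.
  move=> gq mq; have := inv u (m *: u') i q; rewrite gq.
  rewrite dotDr dotZr dotNr /m divfK // subrr => /(_ erefl mu mq) E.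
  by move/eqP: cu; apply; rewrite /c dotDl dotNl E subrr.
have m0 : m != 0 by rewrite /m mulf_neq0 // invr_eq0.
have [mp|mn|m0'] := ltrgtP 0 m; last by rewrite -m0' eqxx in m0.
  by apply: (fin j) => //; apply: maxat_scale.
apply: (fin (o j)); first by rewrite (conf_even C).
have -> : m *: u' = (- m) *: (- u') by rewrite scalerN scaleNr opprK.
by apply: maxat_scale; [rewrite oppr_gt0|exact: (maxat_opp C)].
Qed.

Lemma face_bound (F : {set I}) u : u != 0 -> F \subset face u -> (2 * #|F| <= #|I|)%N.
Proof.
move=> u0 FS; have co : #|[set o i | i in F]| = #|F| by apply: card_imset; apply: can_inj (conf_oppK C).
rewrite mul2n -addnn -{2}co; apply: card_subset_notin.
rewrite disjoint_subset; apply/subsetP => i iF; rewrite inE; apply/negP => /imsetP[j jF ij].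
have /faceP mi := subsetP FS _ iF; have /faceP mj := subsetP FS _ jF.
have := maxat_gt0 C u0 mi; have := maxat_gt0 C u0 mj; rewrite ij (conf_opp C) dotNl; lra.
Qed.

(** Each of three values of [g] occurs twice on the face in direction [e]; the opposite face doubles
    these six vertices. *)
Lemma invariant_bound12 e : e != 0 -> (forall i j, dot (g i - g j) e = 0) -> nonconstant g ->
  (12 <= #|I|)%N.
Proof.
move=> e0 he nc; have [i [j [l [ij jl li]]]] := three_classes nc.
have [a1 [b1 [a1F b1F ab1 ga1 gb1]]] := face_class i he nc.
have [a2 [b2 [a2F b2F ab2 ga2 gb2]]] := face_class j he nc.
have [a3 [b3 [a3F b3F ab3 ga3 gb3]]] := face_class l he nc.
have neg x y : g x != g y -> x != y by apply: contra => /eqP->.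
have u6 : uniq [:: a1; b1; a2; b2; a3; b3].
  rewrite /= !inE !negb_or ab1 ab2 ab3 !neg //;
    rewrite ?ga1 ?ga2 ?ga3 ?gb1 ?gb2 ?gb3 ?ij ?jl // eq_sym //.
have := @face_bound [set x in [:: a1; b1; a2; b2; a3; b3]] e e0.
rewrite cardsE (card_uniqP u6); apply; apply/subsetP => x; rewrite [x \in _]inE.
by rewrite !inE => /or4P[|||/or3P[]]/eqP->; rewrite -?[asbool _]inE; apply/asboolP/faceP.
Qed.

(** The direction is tilted, orthogonally to [k j - k i], so that the possible third vertex of the
    face drops below the other two. *)
Lemma triangle_edge u i j : (#|face u| <= 3)%N -> i != j -> i \in face u -> j \in face u -> edge k i j.
Proof.
move=> c3 ij /faceP mi /faceP mj.
have [v [v0 hv]] : exists v, dot (k j - k i) v = 0 /\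
    forall l, l \in face u -> l != i -> l != j -> 0 < dot (k i - k l) v.
  have [l /and3P[lF li lj]|no] := pickP [pred l | [&& l \in face u, l != i & l != j]]; last first.
    by exists 0; rewrite dot0r; split=> // l lF li lj; have := no l; rewrite /= lF li lj.
  have nc := exposed_notcolinear (conf_exposed C) ij li lj.
  have ji0 : k j - k i != 0 by rewrite subr_eq0; apply: contra ij => /eqP/(conf_inj C)->.
  have [v [v0 hv]] := not_colinear_dot ji0 nc.
  exists (- v); rewrite dotNr v0 oppr0; split=> // x xF xi xj.
  suff -> : x = l by rewrite -opprB dotNl dotNr opprK.
  apply/eqP; apply: contrapT => /negP xl.
  have u4 : uniq [:: i; j; l; x].
    by rewrite /= !inE !negb_or ij (eq_sym i) li (eq_sym i) xi (eq_sym j) lj (eq_sym j) xj (eq_sym l) xl.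
  have : (4 <= #|face u|)%N.
    rewrite -[4%N]/(size [:: i; j; l; x]) -(card_uniqP u4); apply: subset_leq_card.
    apply/subsetP => y; rewrite !inE => /or4P[]/eqP->; apply/asboolP => //; exact/faceP.
  by rewrite leqNgt ltnS c3.
have : near0 (fun s => forall l, l != i -> l != j -> 0 < dot (k i - k l) u + s * dot (k i - k l) v).
  apply: near0_fin => l; have [_|li] := eqVneq l i; first exact: near0T.
  have [_|lj] := eqVneq l j; first exact: near0T.
  have [lF|lF] := boolP (l \in face u).
    have h := hv l lF li lj; have /faceP ml := lF.
    exists 1 => // s /andP[s0 _] _ _; rewrite dotDl dotNl (maxat_eq mi ml) subrr add0r.
    exact: mulr_gt0.
  have : 0 < dot (k i - k l) u.
    rewrite dotDl dotNl subr_gt0 lt_neqAle mi andbT; apply: contra lF => /eqP E.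
    by apply/faceP => x; rewrite E.
  by move=> /(near0_pos (dot (k i - k l) v)); apply: near0_sub.
case/near0_ex => s s0 h; exists (u + s *: v); split.
  move: v0; rewrite !(dotDr, dotZr, dotDl, dotNl) (maxat_eq mi mj); nra.
by move=> l li lj; have := h l li lj; rewrite !(dotDr, dotZr, dotDl, dotNl); nra.
Qed.

(* If the ratio of [g] to [k] agrees on all the edges at each vertex, then it is a
   global constant by connectivity; it changes sign under [o], so it is zero. *)
Lemma ratio_constant : (forall i a b t s, i != a -> i != b -> edge k i a -> edge k i b ->
    g a - g i = t *: (k a - k i) -> g b - g i = s *: (k b - k i) -> t = s) ->
  ~ nonconstant g.
Proof.
move=> star [i0 [j0]].
suff all0 j : g j = g i0 by rewrite !all0 eqxx.
have [n hn] := conf_exposed C i0.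
have above p : p != i0 -> exists a, [/\ edge k p a, p != a & dot (k p) n < dot (k a) n].
  move=> ji; have [|a [ea ha]] := @edge_increasing R d I k p n (conf_exposed C).
    by exists i0; apply: hn.
  by exists a; split=> //; apply: contraTneq ha => ->; rewrite ltxx.
have [a0 [ea0 ia0]] : exists a, edge k i0 a /\ i0 != a.
  have [|a [ea ha]] := @edge_increasing R d I k i0 (- n) (conf_exposed C).
    by exists (o i0); rewrite !dotNr ltrN2; apply: hn; exact: (conf_opp_neq C).
  by exists a; split=> //; apply: contraTneq ha => ->; rewrite ltxx.
have [t tE] := conf_edge C ia0 ea0.
(* Induction on the number of vertices above [k j'] in a direction [n] that exposes [k i0]: an edge
   leads upwards from every other vertex. *)
have main m j' : (#|[pred l | (dot (k j') n < dot (k l) n)%R]| < m)%N ->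
    (forall a, j' != a -> edge k j' a -> g a - g j' = t *: (k a - k j')) /\
    g j' - g i0 = t *: (k j' - k i0).
  elim: m j' => // m IH j' jm.
  have [->|ji] := eqVneq j' i0.
    split; last by rewrite !subrr scaler0.
    move=> a ia ea; have [s sE] := conf_edge C ia ea.
    by rewrite (star _ _ _ _ _ ia0 ia ea0 ea tE sE).
  have [a [ea ja ha]] := above j' ji.
  have [|h1 h2] := IH a.
    rewrite -ltnS; apply: (leq_trans _ jm); rewrite ltnS; apply: proper_card.
    apply/properP; split; first by apply/subsetP => x; rewrite !inE; apply: lt_trans.
    by exists a; rewrite inE // ltxx.
  have aj : a != j' by rewrite eq_sym.
  have E : g j' - g a = t *: (k j' - k a) by apply: h1 => //; exact: edge_sym.
  have E' : g a - g j' = t *: (k a - k j') by rewrite -opprB E -scalerN opprB.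
  split; last by rewrite -[g j'](subrK (g a)) E -addrA h2 -scalerDr addrA subrK.
  move=> b jb eb; have [s sE] := conf_edge C jb eb.
  by rewrite (star _ _ _ _ _ ja jb ea eb E' sE).
have {}main j' := (main _ j' (ltnSn _)).2.
have t0 : t = 0.
  have := main (o i0); rewrite (conf_even C) subrr (conf_opp C) -opprD scalerN -mulr2n.
  move/eqP; rewrite eq_sym oppr_eq0 scaler_eq0 => /orP[/eqP//|].
  by rewrite -scaler_nat scaler_eq0 pnatr_eq0 (negbTE (conf_neq0 C i0)).
by apply/eqP; rewrite -subr_eq0 main t0 scale0r.
Qed.

End Face.

Section Three.
Context {R : realFieldType} {I : finType} {k g : I -> 'rV[R]_3} {o : I -> I}.
Hypothesis C : conf k g o.

Lemma exists_normal_row (u v : 'cV[R]_3) : exists2 x : 'rV[R]_3, x != 0 & dot x u = 0 /\ dot x v = 0.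
Proof.
have c2 : (#|[set: bool]| < 3)%N by rewrite cardsT card_bool.
have [n n0 hn] := exists_annihilator (fun b : bool => if b then u^T else v^T) c2.
exists n^T; first by rewrite trmx_eq0.
have T (y : 'cV[R]_3) : dot n^T y = dot y^T n.
  by rewrite /dot -[in LHS](trmxK y) -trmx_mul mxE.
by split; rewrite T; [have := hn true|have := hn false]; rewrite inE => /(_ isT).
Qed.

(* The boundary of the normal cone of a vertex is connected, so two neighbours
   with different ratios would lie in a common face. *)
Lemma small_faces_ratio : (forall u, u != 0 -> (#|face (k := k) u| <= 3)%N) ->
  forall i a b t s, i != a -> i != b -> edge k i a -> edge k i b ->
    g a - g i = t *: (k a - k i) -> g b - g i = s *: (k b - k i) -> t = s.
Proof.
move=> c3 i a b t s ia ib ea eb tE sE; apply/eqP; apply: contrapT => /negP ts.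
have kn x y : x != y -> k x - k y != 0 by move=> xy; rewrite subr_eq0; apply: contra xy => /eqP/(conf_inj C)->.
pose A v := `[< [/\ i != v, edge k i v & g v - g i = t *: (k v - k i)] >].
have Aa : A a by apply/asboolP.
have nAb : ~~ A b.
  apply/asboolP => -[_ _]; rewrite sE => /(congr1 (fun x => x - t *: (k b - k i))).
  rewrite subrr -scalerBl => /eqP; rewrite scaler_eq0 subr_eq0 eq_sym (negbTE ts) /=.
  by rewrite (negbTE (kn _ _ _)) // eq_sym.
have ab : a != b by apply: contraNneq nAb => <-.
have [ai bi ba] : [/\ a != i, b != i & b != a] by rewrite ![_ == i]eq_sym [b == a]eq_sym.
have [ua [uaE ha]] := ea; have [ub [ubE hb]] := eb.
have [x x0 [xa xb]] := exists_normal_row ua ub.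
have [z [hz xz]] : exists z, exposedat k z i /\ dot x z != 0.
  have [z0 hz0] := conf_exposed C i; have [v hv] := dot_neq0l x0.
  have h1 := exposedat_near0 v hz0.
  have h2 : near0 (fun e => dot x z0 + e * dot x v != 0) by apply: near0_neq0; rewrite (gt_eqF hv) orbT.
  have [e _ [h3 h4]] := near0_ex (near0_and h1 h2).
  by exists (z0 + e *: v); rewrite dotDr dotZr.
have zpos c : c != i -> 0 < dot (k i - k c) z by move=> /hz; rewrite dotDl dotNl subr_gt0.
have ua0 c : c != i -> c != a -> 0 < dot (k i - k c) ua by move=> ci ca; rewrite dotDl dotNl subr_gt0 ha.
have ub0 c : c != i -> c != b -> 0 < dot (k i - k c) ub by move=> ci ca; rewrite dotDl dotNl subr_gt0 hb.
have uaa : dot (k i - k a) ua = 0 by rewrite dotDl dotNl uaE subrr.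
have ubb : dot (k i - k b) ub = 0 by rewrite dotDl dotNl ubE subrr.
have ua1 c : c != i -> 0 <= dot (k i - k c) ua.
  by move=> ci; have [->|ca] := eqVneq c a; [rewrite uaa|exact/ltW/ua0].
have ub1 c : c != i -> 0 <= dot (k i - k c) ub.
  by move=> ci; have [->|ca] := eqVneq c b; [rewrite ubb|exact/ltW/ub0].
(* For [0 <= r <= 1] the direction [(1 - r) *: ua + r *: ub] is shifted by a multiple of the
   interior direction [z] to the boundary of the normal cone of [k i]. The maximizers of
   [p c + r * q c] are the vertices that become tight there. *)
pose p c := - (dot (k i - k c) ua / dot (k i - k c) z).
pose q c := - (dot (k i - k c) ub / dot (k i - k c) z) - p c.
suff : A a = A b by rewrite Aa (negbTE nAb).
apply: (@upper_envelope R I _ (predC1 i) p q A).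
- move=> r /andP[r0 r1] a' b' /= a'i b'i hma hmb.
  have [->//|ab'] := eqVneq a' b'.
  pose tau := - (p a' + r * q a').
  pose u := (1 - r) *: ua + r *: ub - tau *: z.
  have zE c : c != i -> dot (k i - k c) u = dot (k i - k c) z * (- tau - (p c + r * q c)).
    move=> ci; rewrite /u !(dotDr, dotNr, dotZr) /q /p; field.
    by rewrite gt_eqF // zpos.
  have mi : maxat k u i.
    move=> c; have [->//|ci] := eqVneq c i; rewrite -subr_ge0 -dotNl -dotDl zE //.
    by rewrite mulr_ge0 ?(ltW (zpos _ ci)) // /tau opprK subr_ge0 hma.
  have eqm c : c != i -> p c + r * q c = p a' + r * q a' -> maxat k u c.
    move=> ci E; have : dot (k i - k c) u = 0 by rewrite zE // E /tau opprK subrr mulr0.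
    by rewrite dotDl dotNl => /eqP; rewrite subr_eq0 => /eqP E' y; rewrite -E'.
  have ma' : maxat k u a' by apply: eqm.
  have mb' : maxat k u b' by apply: eqm => //; apply/eqP; rewrite eq_le hma // hmb.
  (* [x] is orthogonal to [ua] and [ub] but not to [z], so [u = 0] forces [tau = 0]; then [a] forces
     [r = 0], and [b] gives a contradiction. *)
  have u0 : u != 0.
    apply/negP => /eqP u0.
    have tau0 : tau = 0.
      have : dot x u = 0 by rewrite u0 dot0r.
      rewrite /u !(dotDr, dotNr, dotZr) xa xb !mulr0 !add0r => /eqP.
      by rewrite oppr_eq0 mulf_eq0 (negbTE xz) orbF => /eqP.
    have D c : (1 - r) * dot (k i - k c) ua + r * dot (k i - k c) ub = 0.
      have : dot (k i - k c) u = 0 by rewrite u0 dot0r.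
      by rewrite /u tau0 scale0r subr0 !(dotDr, dotZr).
    have := D a; rewrite uaa mulr0 add0r => /eqP; rewrite mulf_eq0.
    rewrite (gt_eqF (ub0 a ai ab)) orbF => /eqP rz.
    have := D b; rewrite rz subr0 mul1r mul0r addr0 => /eqP.
    by rewrite (gt_eqF (ua0 b bi ba)).
  have tri := triangle_edge C (c3 u u0).
  have [ia' ib'] : i != a' /\ i != b' by rewrite !(eq_sym i).
  have ea' : edge k i a' by apply: tri => //; exact/faceP.
  have eb' : edge k i b' by apply: tri => //; exact/faceP.
  have eab : edge k a' b' by apply: tri => //; exact/faceP.
  have [t1 E1] := conf_edge C ia' ea'; have [t2 E2] := conf_edge C ib' eb'.
  have [t3 E3] := conf_edge C ab' eab.
  (* The sides of the triangle at [k i] are independent, so its three ratios coincide. *)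
  have E : (t2 - t3) *: (k b' - k i) = (t1 - t3) *: (k a' - k i).
    apply/eqP; rewrite -subr_eq0; apply/eqP/dot_eq0l => v.
    have := congr1 (fun x => dot x v) E1; have := congr1 (fun x => dot x v) E2.
    have := congr1 (fun x => dot x v) E3; rewrite !dotE; clear; lra.
  have t23 : t2 = t3.
    apply/eqP; apply: contrapT => /negP h; have h' : t2 - t3 != 0 by rewrite subr_eq0.
    apply: (exposed_notcolinear (conf_exposed C) ia' b'i); first by rewrite eq_sym.
    exists ((t1 - t3) / (t2 - t3)); apply: (scalerI h').
    by rewrite E scalerA mulrCA divff ?mulr1.
  have t13 : t1 = t3.
    move: E; rewrite t23 subrr scale0r => /esym/eqP.
    by rewrite scaler_eq0 (negbTE (kn _ _ a'i)) orbF subr_eq0 => /eqP.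
  subst t2 t1.
  apply/asboolP/asboolP => -[_ _].
    rewrite E1 => /eqP; rewrite -subr_eq0 -scalerBl scaler_eq0 (negbTE (kn _ _ a'i)) orbF subr_eq0.
    by move/eqP => <-.
  rewrite E2 => /eqP; rewrite -subr_eq0 -scalerBl scaler_eq0 (negbTE (kn _ _ b'i)) orbF subr_eq0.
  by move/eqP => <-.
- by rewrite /= eq_sym.
- by rewrite /= eq_sym.
- by move=> c /= ci; rewrite /p uaa mul0r oppr0 oppr_le0 divr_ge0 // ?ua1 // ltW // zpos.
- move=> c /= ci; rewrite /q ![p _ + _]addrC !subrK ubb mul0r oppr0 oppr_le0.
  by rewrite divr_ge0 // ?ub1 // ltW // zpos.
Qed.

Lemma exists_large_face : nonconstant g -> exists u, u != 0 /\ (4 <= #|face (k := k) u|)%N.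
Proof.
move=> nc; apply: contrapT => no.
apply: (ratio_constant C (small_faces_ratio _)) nc => u u0.
by rewrite leqNgt; apply/negP => h; apply: no; exists u.
Qed.

(* The direction leads from a point of the polytope at the same height to [k l]; that
   point is a convex combination of points of the face and of the opposite face. *)
Lemma large_face_direction u l : (4 <= #|face (k := k) u|)%N -> u != 0 ->
  l \notin face (k := k) u -> o l \notin face (k := k) u ->
  exists w, [/\ generic_direction (k := k) (g := g) w, dot w u = 0 & l \notin survivors (k := k) w].
Proof.
move=> c4 u0 lF olF.
have [f0 f0F] : exists f, f \in face (k := k) u by apply/card_gt0P; lia.
have /faceP mf0 := f0F.
pose h := dot (k f0) u; have h0 : 0 < h by apply: (maxat_gt0 C u0 mf0).
have hF f : f \in face (k := k) u -> dot (k f) u = h by move=> /faceP mf; apply: maxat_eq mf mf0.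
have nF c : c \notin face (k := k) u -> dot (k c) u < h.
  move=> cF; rewrite lt_neqAle mf0 andbT; apply: contra cF => /eqP E.
  by apply/faceP => x; rewrite E.
have l1 : dot (k l) u < h by apply: nF.
have l2 : - h < dot (k l) u by have := nF _ olF; rewrite (conf_opp C) dotNl; lra.
pose al := (h + dot (k l) u) / (2 * h); pose be := (h - dot (k l) u) / (2 * h).
have al0 : 0 < al by rewrite divr_gt0; lra.
have be0 : 0 < be by rewrite divr_gt0; lra.
have abE : al + be = 1 by rewrite /al /be; field; rewrite gt_eqF.
have abh : al * h - be * h = dot (k l) u by rewrite /al /be; field; rewrite gt_eqF.
(* [al] and [be] are chosen so that the combination of [k f] and [- k f0] has the same height as
   [k l]. *)
pose W f := k l - (al *: k f - be *: k f0).
have Wu f : f \in face (k := k) u -> dot (W f) u = 0.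
  by move=> /hF E; rewrite /W !dotE E -/h abh subrr.
have WB f f' : W f' - W f = - al *: (k f' - k f).
  by apply/eqP; rewrite -subr_eq0; apply/eqP/dot_eq0l => v; rewrite /W !dotE; ring.
have kn x y : x != y -> k x - k y != 0 by move=> xy; rewrite subr_eq0; apply: contra xy => /eqP/(conf_inj C)->.
(* Moving from [W f1] slightly towards [W f2] replaces [k f1] by a point of the segment to [k f2],
   so the direction keeps its form while becoming generic. Three vertices of the face, not being
   collinear, contain a suitable pair. *)
have [f1 [f2 [f1F f2F W1 nc]]] : exists f1 f2, [/\ f1 \in face (k := k) u, f2 \in face (k := k) u, W f1 != 0 & ~ colinear (W f1) (k f2 - k f1)].
  have /card_gt2P [a [b [c [[aF bF cF] [ab bc ca]]]]] : (2 < #|face (k := k) u|)%N by apply: leq_trans c4.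
  have cb : c != b by rewrite eq_sym.
  have nabc := exposed_notcolinear (conf_exposed C) ab ca cb.
  have [Wa|Wa] := eqVneq (W a) 0.
    have Wb : W b = - al *: (k b - k a) by rewrite -WB Wa subr0.
    exists b, c; split=> //.
      by rewrite Wb scaler_eq0 oppr_eq0 (gt_eqF al0) /= kn // eq_sym.
    move=> [t tE]; apply: nabc; exists (1 - t * al).
    by rewrite -[k c](subrK (k b)) tE Wb -addrA addrC scalerBl scale1r scalerA mulrN scaleNr.
  have [[t tE]|] := pselect (colinear (W a) (k b - k a)); last by exists a, b.
  have [[s sE]|] := pselect (colinear (W a) (k c - k a)); last by exists a, c.
  have t0 : t != 0.
    by apply/eqP => t0; move: (kn b a); rewrite tE t0 scale0r eqxx eq_sym ab => /(_ isT).
  by case: nabc; exists (s / t); rewrite tE sE scalerA divfK.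
have nc' : ~ colinear (W f1) (W f2 - W f1).
  move=> [t tE]; apply: nc; exists (- (t / al)).
  have an0 : - al != 0 by rewrite oppr_eq0 gt_eqF.
  apply: (scalerI an0); rewrite -WB tE scalerA; congr (_ *: _); field.
  by rewrite gt_eqF.
have [s s0 [s1 gw]] := near0_ex (near0_and (near0_lt ltr01) (generic_direction_family C W1 nc')).
exists (W f1 + s *: (W f2 - W f1)); split=> //.
  by rewrite dotDl Wu // dotZl WB dotZl dotDl dotNl !hF // subrr !mulr0 addr0.
apply/survivorsP => -[u' wu hl].
have nl f : f \in face (k := k) u -> f != l by apply: contraTneq => ->.
have h1 := hl f1 (nl _ f1F); have h2 := hl f2 (nl _ f2F).
have h3 : - dot (k f0) u' < dot (k l) u'.
  rewrite -dotNl -(conf_opp C); apply: hl; apply: contraNneq olF => <-.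
  by rewrite (conf_oppK C).
move: wu; rewrite /W !dotE.
have -> : be = 1 - al by lra.
have al1 : al < 1 by lra.
set x := dot (k l) u' in h1 h2 h3 *; set y1 := dot (k f1) u' in h1 *.
set y2 := dot (k f2) u' in h2 *; set y0 := dot (k f0) u' in h3 *.
clear -al0 al1 s0 s1 h1 h2 h3 => E.
have p1 : 0 < al * (1 - s) * (x - y1) by apply: mulr_gt0; [apply: mulr_gt0|]; lra.
have p2 : 0 < al * s * (x - y2) by apply: mulr_gt0; [apply: mulr_gt0|]; lra.
have p3 : 0 < (1 - al) * (x + y0) by apply: mulr_gt0; lra.
nra.
Qed.

Lemma vertex_bound3 : nonconstant g -> (12 <= #|I|)%N.
Proof.
move=> nc.
have [[e [e0 he]]|noA] := pselect (exists e, e != 0 /\ forall i j, dot (g i - g j) e = 0).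
  exact: (invariant_bound12 C e0 he nc).
have {}noA e : (forall i j, dot (g i - g j) e = 0) -> e = 0.
  by move=> he; apply/eqP; apply: contrapT => /negP e0; apply: noA; exists e.
have [u [u0 c4]] := exists_large_face nc.
(* If every vertex were on the face or its opposite, all [g i] would have the same inner product
   with [u]. *)
have [l /andP[lF olF]] : exists l, (l \notin face (k := k) u) && (o l \notin face (k := k) u).
  apply: contrapT => no; move/eqP: u0; apply; apply: noA.
  have [f0 f0F] : exists f, f \in face (k := k) u by apply/card_gt0P; lia.
  have /faceP m0 := f0F.
  suff all0 i : dot (g i) u = dot (g f0) u by move=> i j; rewrite dotDl dotNl !all0 subrr.
  have [iF|iF] := boolP (i \in face (k := k) u).
    by apply: (conf_compat C) m0; exact/faceP.
  have [iF'|iF'] := boolP (o i \in face (k := k) u); last by case: no; exists i; rewrite iF.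
  by rewrite -(conf_even C i); apply: (conf_compat C) m0; exact/faceP.
have [w [gw wu lS]] := large_face_direction c4 u0 lF olF.
have [h1 h2 h3 h4] := survivors_conf C gw.
(* Parallel to [w], the face projects into a line, where at most two of its at least four vertices
   survive. *)
have [a [b [aF bF ab aS bS]]] : exists a b, [/\ a \in face (k := k) u, b \in face (k := k) u,
    a != b, a \notin survivors (k := k) w & b \notin survivors (k := k) w].
  have : (1 < #|face (k := k) u :\: survivors (k := k) w|)%N.
    have := h4 u erefl u0 wu; have := cardsID (survivors (k := k) w) (face (k := k) u).
    have -> : [set i in survivors (k := k) w | `[< maxat k u i >]] = face (k := k) u :&: survivors (k := k) w.
      by apply/setP => i; rewrite !inE andbC.
    lia.
  case/card_gt1P => a [b []]; rewrite !inE => /andP[aS aF] /andP[bS bF] ab.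
  by exists a, b; rewrite !inE.
have c6 : (#|survivors (k := k) w| + 6 <= #|I|)%N.
  have pos x : x \in face (k := k) u -> 0 < dot (k x) u by move=> /faceP; apply: (maxat_gt0 C u0).
  have neg x y : x \in face (k := k) u -> y \in face (k := k) u -> o x != y.
    move=> xF yF; apply/negP => /eqP E; have := pos _ yF; have := pos _ xF.
    by rewrite -E (conf_opp C) dotNl; lra.
  have nl x : x \in face (k := k) u -> (x != l) && (x != o l).
    by move=> xF; apply/andP; split; [apply: contraNneq lF => <-|apply: contraNneq olF => <-].
  have nol x : x \in face (k := k) u -> (o x != l) && (o x != o l).
    move=> xF; apply/andP; split.
      by apply: contraNneq olF => <-; rewrite (conf_oppK C).
    by apply: contraNneq lF => E; rewrite -(conf_oppK C l) -E (conf_oppK C).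
  have oab : o a != o b.
    by apply: contra ab => /eqP E; rewrite -(conf_oppK C a) E (conf_oppK C).
  have u6 : uniq [:: a; b; o a; o b; l; o l].
    have /andP[al aol] := nl a aF; have /andP[bl bol] := nl b bF.
    have /andP[oal oaol] := nol a aF; have /andP[obl obol] := nol b bF.
    rewrite /= !inE !negb_or ab al aol bl bol oal oaol obl obol oab.
    rewrite (eq_sym a (o a)) (eq_sym a (o b)) (eq_sym b (o a)) (eq_sym b (o b)).
    by rewrite (eq_sym l (o l)) !(conf_opp_neq C) !neg.
  have E : #|[set x in [:: a; b; o a; o b; l; o l]]| = 6%N by rewrite cardsE; exact/card_uniqP.
  rewrite -E; apply: card_subset_notin; rewrite disjoint_sym disjoint_subset.
  apply/subsetP => x; rewrite [x \in _]inE => xE.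
  suff : x \notin survivors (k := k) w by [].
  have oS := survivors_opp_notin C.
  by rewrite !inE in xE; case/or4P: xE => [|||/or3P[]] /eqP-> //; apply: oS.
have [hn|no] := pselect (exists i j, [/\ i \in survivors (k := k) w, j \in survivors (k := k) w & g i != g j]).
  by apply: leq_trans c6; rewrite (leq_add2r 6 6); exact: (h2 hn (@vertex_bound2 R)).
have [c cS _] := h3 0 (dot0r w).
apply: (conf_class_bound C (i0 := c)) => //.
apply: (leq_trans h1); apply: subset_leq_card; apply/subsetP => x xS; rewrite inE.
by apply: contrapT => /negP xc; apply: no; exists x, c.
Qed.

End Three.

Theorem vertex_bound_ge3 (R : realFieldType) d : (2 < d)%N -> vertex_bound R d.
Proof.
elim: d => // d IH; rewrite ltnS leq_eqVlt => /orP[/eqP<-|d2].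
  by move=> I k g o C nc; exact: vertex_bound3 C nc.
move=> I k g o C nc; have -> : min_vertices d.+1 = (4 * d.+1)%N by rewrite /min_vertices; case: eqP => //; lia.
exact: step_bound C d2 nc (IH d2).
Qed.

(** * The vertices of the difference body *)

Section Hull.
Context {R : realType} {d : nat}.
Implicit Types (A : set 'rV[R]_d) (X : {fset 'rV[R]_d}) (u : 'cV[R]_d) (x y z : 'rV[R]_d).

Lemma convex_set_intro A : (forall x y t, A x -> A y -> 0 <= t <= 1 -> A (t *: x + (1 - t) *: y)) ->
  @convex_set R 'rV[R]_d A.
Proof.
move=> h x y t /set_mem Ax /set_mem Ay; apply/mem_set.
by apply: h => //; rewrite ge0 le1.
Qed.

Lemma convex_set_comb A x y t : @convex_set R 'rV[R]_d A -> A x -> A y -> 0 <= t <= 1 ->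
  A (t *: x + (1 - t) *: y).
Proof.
move=> cA Ax Ay t01.
have := cA x y (Itv01 (andP t01).1 (andP t01).2) (mem_set Ax) (mem_set Ay).
by move/set_mem.
Qed.

Lemma convex_hull_convex A : @convex_set R 'rV[R]_d (convex_hull A).
Proof.
apply: convex_set_intro => x y t hx hy t01 B [cB AB]; apply: convex_set_comb => //.
  by apply: hx.
by apply: hy.
Qed.

Lemma sub_convex_hull A : (A `<=` convex_hull A)%classic.
Proof. exact: sub_gen_smallest. Qed.

Lemma hull_le A u b : (forall x, A x -> dot x u <= b) -> forall x, convex_hull A x -> dot x u <= b.
Proof.
move=> h; apply: smallest_sub; last by move=> x /h.
apply: convex_set_intro => x y t /= hx hy /andP[t0 t1]; rewrite dotDl !dotZl.
have := ler_wpM2l t0 hx; have t1' : 0 <= 1 - t by lra.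
have := ler_wpM2l t1' hy; lra.
Qed.

Lemma hull_lt A u b : (forall x, A x -> dot x u < b) -> forall x, convex_hull A x -> dot x u < b.
Proof.
move=> h; apply: smallest_sub; last by move=> x /h.
apply: convex_set_intro => x y t /= hx hy /andP[t0 t1]; rewrite dotDl !dotZl.
have [->|tn] := eqVneq t 0; first by rewrite subr0 mul0r mul1r add0r.
have tp : 0 < t by rewrite lt_neqAle eq_sym tn.
have : t * dot x u < t * b by rewrite ltr_pM2l.
have t1' : 0 <= 1 - t by lra.
have := ler_wpM2l t1' (ltW hy); lra.
Qed.

Lemma hull_exposed A u x : (forall z, A z -> z != x -> dot z u < dot x u) ->
  forall z, convex_hull A z -> z != x -> dot z u < dot x u.
Proof.
move=> h z hz zx.
have : z = x \/ dot z u < dot x u; last by case=> // E; rewrite E eqxx in zx.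
move: z hz {zx}; apply: smallest_sub; last first.
  by move=> z Az; have [->|/(h z Az)] := eqVneq z x; [left|right].
apply: convex_set_intro => a b t ha hb /andP[t0 t1].
have [->|tn] := eqVneq t 0; first by rewrite subr0 scale0r scale1r add0r.
have [->|t1n] := eqVneq t 1; first by rewrite subrr scale0r scale1r addr0.
have tp : 0 < t by rewrite lt_neqAle eq_sym tn.
have tp1 : 0 < 1 - t by rewrite subr_gt0 lt_neqAle t1n.
case: ha => [->|ha]; case: hb => [->|hb].
- by left; rewrite -scalerDl addrC subrK scale1r.
- right; rewrite dotDl !dotZl; have : (1 - t) * dot b u < (1 - t) * dot x u by rewrite ltr_pM2l.
  lra.
- right; rewrite dotDl !dotZl; have : t * dot a u < t * dot x u by rewrite ltr_pM2l.
  lra.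
- right; rewrite dotDl !dotZl; have : (1 - t) * dot b u < (1 - t) * dot x u by rewrite ltr_pM2l.
  have : t * dot a u < t * dot x u by rewrite ltr_pM2l.
  lra.
Qed.

Definition strict_max X u x := forall z, z \in X -> z != x -> dot z u < dot x u.

Lemma hyperplane_eq (a a' : 'cV[R]_d) b b' x : hyperplane a b = hyperplane a' b' ->
  a != 0 -> a' != 0 -> dot x a = b -> exists2 l, l != 0 & a' = l *: a.
Proof.
move=> E a0 a'0 xb.
have x' : dot x a' = b' by have : hyperplane a b x by []; rewrite E.
have T (n : 'cV[R]_d) (y : 'cV[R]_d) : dot n^T y = dot y^T n.
  by rewrite /dot -[in LHS](trmxK y) -trmx_mul mxE.
have [|v hv|l lE] := @colinear_dot R d a^T a'^T.
- by rewrite trmx_eq0.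
- have va : dot v^T a = 0 by rewrite -T.
  have : hyperplane a b (x + v^T) by rewrite /hyperplane /= -/(dot _ _) dotDl va addr0.
  rewrite E /hyperplane /= -/(dot _ _) dotDl x' T => h; lra.
have aE : a' = l *: a by rewrite -[LHS]trmxK lE linearZ /= trmxK.
exists l => //; apply: contra a'0 => /eqP l0; by rewrite aE l0 scale0r.
Qed.

Lemma supporting_strict X (H : set 'rV[R]_d) x : supporting_hyperplane (convex_hull [set` X]) H ->
  ([set` X] `&` H = [set x])%classic ->
  exists a b, [/\ a != 0, H = hyperplane a b, dot x a = b, x \in X & strict_max X a x].
Proof.
move=> [a [b [a0 HE hle _]]] XH.
have [xX xH] : [set` X]%classic x /\ H x.
  by have : (([set` X] `&` H) x)%classic by rewrite XH.
have xb : dot x a = b by move: xH; rewrite HE.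
exists a, b; split=> // z zX zx; rewrite xb lt_neqAle.
have -> : dot z a <= b by apply: hle; apply: sub_convex_hull.
rewrite andbT; apply: contra zx => /eqP zb; apply/eqP.
have : (([set` X] `&` H) z)%classic by split=> //; rewrite HE.
by rewrite XH.
Qed.

(** The normals of the two hyperplanes are proportional. A positive factor would make [x] and [y]
    strict maxima of the same direction, so the factor is negative. *)
Lemma strictly_antipodalP X x y :
  strictly_antipodal X x y <->
  [/\ x \in X, y \in X, x != y & exists u, strict_max X u x /\ strict_max X (- u) y].
Proof.
split=> [[xX yX xy [H1 [H2 [[s1 s2] [a [b1 [b2 [a0 E1 E2]]]] _ X1 X2]]]]|].
  split=> //.
  have [a1 [c1 [a10 F1 xc _ m1]]] := supporting_strict s1 X1.
  have [a2 [c2 [a20 F2 yc _ m2]]] := supporting_strict s2 X2.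
  have [l l0 lE] : exists2 l, l != 0 & a = l *: a1.
    by apply: (hyperplane_eq _ a10 a0 xc); rewrite -F1 E1.
  have [m m0 mE] : exists2 l, l != 0 & a = l *: a2.
    by apply: (hyperplane_eq _ a20 a0 yc); rewrite -F2 E2.
  exists a1; split=> //.
  have a2E : a2 = (l / m) *: a1.
    by apply: (scalerI m0); rewrite -mE lE scalerA mulrCA divff ?mulr1.
  have lm0 : l / m != 0 by rewrite mulf_neq0 // invr_eq0.
  move=> z zX zy; have := m2 z zX zy; rewrite a2E !dotZr !dotNr ltrN2.
  have [lp|ln|E] := ltrgtP 0 (l / m); last by rewrite -E eqxx in lm0.
    have := m2 x xX xy; rewrite a2E !dotZr ltr_pM2l // => h.
    by have := m1 y yX; rewrite eq_sym xy => /(_ isT) h'; have := lt_trans h h'; rewrite ltxx.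
  by rewrite ltr_nM2l.
move=> [xX yX xy [u [mx my]]]; split=> //.
have yx : dot y u < dot x u by apply: mx; rewrite // eq_sym.
have u0 : u != 0 by apply/eqP => E; rewrite E !dot0r ltxx in yx.
exists (hyperplane u (dot x u)), (hyperplane u (dot y u)); split.
- split.
    exists u, (dot x u); split=> //; last by exists x; split=> //; apply: sub_convex_hull.
    apply: hull_le => z zX; have [->//|zx] := eqVneq z x; exact/ltW/mx.
  exists (- u), (- dot y u); split.
  + by rewrite oppr_eq0.
  + apply/seteqP; split=> z; rewrite /hyperplane /= -!/(dot _ _) dotNr; first by move=> ->.
    exact: oppr_inj.
  + move=> z hz; rewrite /= -/(dot _ _) -dotNr; move: z hz; apply: hull_le => z zX.
    by have [->//|zx] := eqVneq z y; exact/ltW/my.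
  + by exists y; split=> //; apply: sub_convex_hull.
- by exists u, (dot x u), (dot y u).
- move=> E; have : hyperplane u (dot x u) x by [].
  by rewrite E /hyperplane /= -/(dot _ _) => h; rewrite h ltxx in yx.
- apply/seteqP; split=> [z [zX zH]|z ->]; last by split.
  apply/eqP; apply: contrapT => /negP zx; have := mx z zX zx.
  by move: zH; rewrite /hyperplane /= -/(dot _ _) => ->; rewrite ltxx.
- apply/seteqP; split=> [z [zX zH]|z ->]; last by split.
  apply/eqP; apply: contrapT => /negP zx; have := my z zX zx.
  by move: zH; rewrite /hyperplane /= -/(dot _ _) !dotNr => ->; rewrite ltxx.
Qed.

Lemma strictly_antipodal_sym X x y : strictly_antipodal X x y -> strictly_antipodal X y x.
Proof.
move=> /strictly_antipodalP [xX yX xy [u [mx my]]]; apply/strictly_antipodalP.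
split=> //; first by rewrite eq_sym.
by exists (- u); rewrite opprK.
Qed.

Lemma strictly_convex_exposed X x : strictly_convex_position X -> x \in X ->
  exists u, strict_max X u x.
Proof.
rewrite /strictly_convex_position => E xX.
have [H sH HE] : vert (convex_hull [set` X]) x by rewrite -E.
have [|a [b [_ _ _ _ m]]] := supporting_strict (x := x) sH; last by exists a.
apply/seteqP; split=> [z [zX zH]|z ->].
  by have : (convex_hull [set` X] `&` H)%classic z by [split=> //; apply: sub_convex_hull]; rewrite HE.
split=> //; have : (convex_hull [set` X] `&` H)%classic x by rewrite HE.
by case.
Qed.

Lemma exists_other X x : (1 < #|` X|)%N -> exists2 y, y \in X & y != x.
Proof.
move=> c2; apply: contrapT => no; move: c2; rewrite ltnNge; apply/negP; rewrite negbK.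
rewrite -[leqRHS](cardfs1 x); apply: fsubset_leq_card; apply/fsubsetP => y yX.
by rewrite in_fset1; apply: contrapT => /negP yx; apply: no; exists y.
Qed.

Lemma exposed_strictly_convex X : (1 < #|` X|)%N ->
  (forall x, x \in X -> exists u, strict_max X u x) -> strictly_convex_position X.
Proof.
move=> c2 hX; apply/seteqP; split=> [x xX|v].
  have [u mx] := hX x xX.
  have [y yX yx] := exists_other x c2.
  have u0 : u != 0 by apply/eqP => E; have := mx y yX yx; rewrite E !dot0r ltxx.
  exists (hyperplane u (dot x u)).
    exists u, (dot x u); split=> //; last by exists x; split=> //; apply: sub_convex_hull.
    apply: hull_le => z zX; have [->//|zx] := eqVneq z x; exact/ltW/mx.
  apply/seteqP; split=> [z [zX zH]|z ->]; last by split=> //; apply: sub_convex_hull.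
  apply/eqP; apply: contrapT => /negP zx; have := hull_exposed (A := [set` X]) mx zX zx.
  by move: zH; rewrite /hyperplane /= -/(dot _ _) => ->; rewrite ltxx.
move=> [H [a [b [a0 HE hle _]]] Hv]; apply: contrapT => vX.
have [hv vH] : (convex_hull [set` X] `&` H)%classic v by rewrite Hv.
have vb : dot v a = b by move: vH; rewrite HE.
suff : dot v a < b by rewrite vb ltxx.
apply: (hull_lt (A := [set` X])) hv => z zX.
have zb : dot z a <= b by apply: hle; apply: sub_convex_hull.
rewrite lt_neqAle zb andbT; apply/negP => /eqP E.
have : (convex_hull [set` X] `&` H)%classic z by split; [exact: sub_convex_hull|rewrite HE].
by rewrite Hv => zv; apply: vX; rewrite -zv.
Qed.

End Hull.

(** * Strictly antipodal pairs as vertices of the difference body *)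

Section Pairs.
Context {R : realType} {d : nat} (X : {fset 'rV[R]_d.+1}).
Hypothesis affX : affine_hull X = [set: _]%classic.

Lemma affine_const (u : 'cV[R]_d.+1) b : (forall x, x \in X -> dot x u = b) -> u = 0.
Proof.
move=> h; have all_b y : dot y u = b.
  have [w [w1 ->]] : affine_hull X y by rewrite affX.
  rewrite -[RHS]mul1r -w1 mulr_suml /dot mulmx_suml summxE.
  rewrite big_seq [RHS]big_seq; apply: eq_bigr => x xX.
  by rewrite -[LHS]/(dot _ _) dotZl h.
by apply: dot_eq0r => x; rewrite all_b -(all_b 0) dot0l.
Qed.

Lemma affine_card : (1 < #|` X|)%N.
Proof.
rewrite ltnNge; apply/negP => c1.
have [x0 hx] : exists x0, forall x, x \in X -> x = x0.
  have [XE|[x0 x0X]] := fset_0Vmem X; first by exists 0 => x; rewrite XE inE.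
  exists x0 => x xX; apply/eqP; apply: contrapT => /negP xx0; move: c1.
  rewrite leqNgt; apply/negP; rewrite negbK.
  have <- : #|` [fset x; x0]%fset| = 2%N by rewrite cardfs2 xx0.
  by apply: fsubset_leq_card; apply/fsubsetP => y; rewrite !inE => /orP[]/eqP->.
have : const_mx 1 = 0 :> 'cV[R]_d.+1.
  by apply: (affine_const (b := dot x0 (const_mx 1))) => x /hx ->.
by move/colP/(_ 0); rewrite !mxE => /eqP; rewrite oner_eq0.
Qed.

(** The pairs are ordered, so that [pair_diff] enumerates the vertices of [P - P] and [pair_swap] is
    its central symmetry. *)
Definition pairs := {p : X * X | `[< strictly_antipodal X (val p.1) (val p.2) >]}.

Definition pair_diff (p : pairs) := val (val p).1 - val (val p).2.
Definition pair_sum (p : pairs) := val (val p).1 + val (val p).2.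

Lemma pairP (p : pairs) : strictly_antipodal X (val (val p).1) (val (val p).2).
Proof. by apply/asboolP; case: p. Qed.

Lemma swap_subproof (p : pairs) :
  `[< strictly_antipodal X (val ((val p).2, (val p).1).1) (val ((val p).2, (val p).1).2) >].
Proof. by apply/asboolP; apply: strictly_antipodal_sym; exact: pairP. Qed.

Definition pair_swap (p : pairs) : pairs := exist _ ((val p).2, (val p).1) (swap_subproof p).

Lemma exists_pair x y : strictly_antipodal X x y ->
  exists p : pairs, val (val p).1 = x /\ val (val p).2 = y.
Proof.
move=> h; have [xX yX _ _] := h.
have P : `[< strictly_antipodal X (val ([` xX]%fset, [` yX]%fset).1) (val ([` xX]%fset, [` yX]%fset).2) >].
  exact/asboolP.
by exists (exist _ ([` xX]%fset, [` yX]%fset) P).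
Qed.

(** A small generic perturbation of [u] makes both extremes unique, and these extremes are still
    extremes of [u]. *)
Lemma perturbed_pair u : exists x y, [/\ strictly_antipodal X x y,
  forall z, z \in X -> dot z u <= dot x u & forall z, z \in X -> dot y u <= dot z u].
Proof.
have kinj : injective (fun x : X => val x) by exact: val_inj.
have [v hv] := generic_injective kinj.
have [x0 x0X] : exists x0, x0 \in X by have := affine_card; case: (fset_0Vmem X) => [->|[x ?]]; [rewrite cardfs0|exists x].
have hv' (i j : X) : i != j -> dot (val i) (- v) != dot (val j) (- v).
  by move=> /hv; rewrite !dotNr; apply: contra => /eqP/oppr_inj->.
have [x [mx ex]] := exposed_maximizer_generic u [` x0X]%fset hv.
have [y [my ey]] := exposed_maximizer_generic (- u) [` x0X]%fset hv'.
have [s s0 [sx sy]] := near0_ex (near0_and ex ey).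
have yE : - u + s *: - v = - (u + s *: v) by rewrite scalerN opprD.
have m1 : strict_max X (u + s *: v) (val x).
  by move=> z zX zx; apply: (sx [` zX]%fset); apply: contra zx => /eqP<-.
have m2 : strict_max X (- (u + s *: v)) (val y).
  by rewrite -yE => z zX zx; apply: (sy [` zX]%fset); apply: contra zx => /eqP<-.
exists (val x), (val y); split.
- apply/strictly_antipodalP; split; rewrite ?fsvalP //; last by exists (u + s *: v).
  apply/negP => /eqP xy; have [z zX zx] := exists_other (val x) affine_card.
  have := m2 z zX; rewrite -xy zx !dotNr ltrN2 => /(_ isT) h.
  by have := lt_trans h (m1 z zX zx); rewrite ltxx.
- by move=> z zX; apply: (mx [` zX]%fset).
- by move=> z zX; have := my [` zX]%fset; rewrite !dotNr lerN2.
Qed.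

(** Compatibility holds because at any maximizing pair the value of [pair_sum] is the maximum plus
    the minimum of [u] on [X]. *)
Lemma pairs_conf : conf pair_diff pair_sum pair_swap.
Proof.
split.
- move=> p; have /strictly_antipodalP [_ _ _ [u [mx my]]] := pairP p; exists u => q qp.
  rewrite /pair_diff !dotDl !dotNl.
  have h1 (z : X) : dot (val z) u <= dot (val (val p).1) u.
    by have [->//|zx] := eqVneq (val z) (val (val p).1); apply/ltW/mx => //; exact: fsvalP.
  have h2 (z : X) : dot (val (val p).2) u <= dot (val z) u.
    have [->//|zx] := eqVneq (val z) (val (val p).2).
    by have := my (val z) (fsvalP _) zx; rewrite !dotNr ltrN2 => /ltW.
  have [E1|n1] := eqVneq (val q).1 (val p).1; last first.
    have : dot (val (val q).1) u < dot (val (val p).1) u by apply: mx; rewrite ?fsvalP.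
    by have := h2 (val q).2; lra.
  have n2 : (val q).2 != (val p).2.
    apply: contra qp => /eqP E2; apply/eqP/val_inj.
    by rewrite [LHS]surjective_pairing [RHS]surjective_pairing E1 E2.
  have : dot (val (val q).2) (- u) < dot (val (val p).2) (- u) by apply: my; rewrite ?fsvalP.
  by rewrite !dotNr E1; lra.
- by move=> p; rewrite /pair_diff /= opprB.
- by move=> p; rewrite /pair_sum /= addrC.
- move=> u p q hp hq.
  have [x [y [/exists_pair [p0 [<- <-]] mx my]]] := perturbed_pair u.
  have E r : maxat pair_diff u r -> dot (pair_sum r) u = dot (pair_sum p0) u.
    move=> /(_ p0); rewrite /pair_diff /pair_sum !dotDl !dotNl.
    have := mx _ (fsvalP (val r).1); have := my _ (fsvalP (val r).2); lra.
  by rewrite !E.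
- move=> u hu.
  have [x [y [/exists_pair [p0 [<- <-]] mx my]]] := perturbed_pair u.
  have := hu p0; rewrite /pair_diff !dotDl !dotNl => h0.
  apply: (affine_const (b := dot (val (val p0).1) u)) => z zX.
  by have := mx z zX; have := my z zX; lra.
Qed.

Lemma card_pairs : #|{: pairs}| = (2 * sa X)%N.
Proof.
rewrite /sa; set S := (X in #|` X|%fset).
pose f (p : pairs) := [fset val (val p).1; val (val p).2]%fset.
have fS p : f p \in S.
  rewrite !inE; apply/andP; split.
    by rewrite fpowersetE; apply/fsubsetP => z; rewrite !inE => /orP[]/eqP->; exact: fsvalP.
  by apply/asboolP; exists (val (val p).1), (val (val p).2); split=> //; exact: pairP.
rewrite cardfE -sum1_card (partition_big (fun p => [` fS p]%fset) predT) //=.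
rewrite mulnC -sum_nat_const; apply: eq_bigr => A _.
rewrite sum1_card.
have /= := fsvalP A; rewrite !inE => /andP[_ /asboolP [x [y [sxy AE]]]].
have [p [px py]] := exists_pair sxy; have [_ _ xy _] := sxy.
have ps : p != pair_swap p.
  by apply: contra xy => /eqP /(congr1 (fun q => val (val q).1)); rewrite /= px py => ->.
have <- : #|[set p; pair_swap p]%SET| = 2%N by rewrite cards2 ps.
have pairE (q r : pairs) : val (val q).1 = val (val r).1 -> val (val q).2 = val (val r).2 -> q = r.
  move=> /val_inj E1 /val_inj E2; apply: val_inj.
  by rewrite [LHS]surjective_pairing [RHS]surjective_pairing E1 E2.
apply: eq_card => q; rewrite !inE unfold_in /=; apply/eqP/orP => [fq0|].
  have fq : f q = fsval A by apply: val_inj.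
  have q1 : val (val q).1 \in [fset x; y]%fset by rewrite -AE -fq !inE eqxx.
  have q2 : val (val q).2 \in [fset x; y]%fset by rewrite -AE -fq !inE eqxx orbT.
  have [_ _ q12 _] := pairP q.
  move: q1 q2; rewrite !inE => /orP[]/eqP q1 /orP[]/eqP q2; rewrite q1 q2 ?eqxx // in q12.
    by left; apply/eqP/pairE; rewrite ?px ?py.
  by right; apply/eqP/pairE; rewrite /= ?px ?py.
by case=> /eqP->; congr enum_fset; rewrite AE /f /= px py // fsetUC.
Qed.

End Pairs.

(** The reflection [x |-> c - x] exchanges maxima and minima of a direction, so the partner of [x]
    is [c - x]. *)
Lemma symmetric_pairs (R : realType) d (X : {fset 'rV[R]_d.+1}) (c : 'rV[R]_d.+1) :
  (forall x, x \in X -> c - x \in X) -> forall p q : pairs X, pair_sum p = pair_sum q.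
Proof.
move=> sX; suff h (p : pairs X) : pair_sum p = c by move=> p q; rewrite !h.
have /strictly_antipodalP [xX yX xy [u [mx my]]] := pairP p; rewrite /pair_sum.
set x := val (val p).1 in xX xy mx *; set y := val (val p).2 in yX xy my *.
apply/eqP; rewrite addrC -subr_eq0 -opprB oppr_eq0 opprD addrA addrAC subr_eq0 eq_sym.
apply: contrapT => /negP n.
have h1 := my _ (sX x xX); rewrite eq_sym n in h1.
have h2 := mx _ (sX y yX).
have n2 : c - y != x by apply: contra n => /eqP <-; rewrite opprB addrC subrK.
have := h1 isT; have := h2 n2; rewrite !dotNr !dotDl !dotNl; lra.
Qed.

(** * Constant sums or many pairs *)

Section Dichotomy.
Context {R : realType} {d : nat} {X : {fset 'rV[R]_d.+1}}.
Hypotheses (affX : affine_hull X = [set: _]%classic) (scX : strictly_convex_position X).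

(** A direction exposing [x] is perturbed until its minimum is unique as well. *)
Lemma exists_partner x : x \in X -> exists p : pairs X, val (val p).1 = x.
Proof.
move=> xX; have [u mx] := strictly_convex_exposed scX xX.
have kinj : injective (fun x : X => val x) by exact: val_inj.
have kinj' : injective (fun x : X => - val x) by move=> a b /oppr_inj/val_inj.
have [v hv] := generic_injective kinj'.
have hx : exposedat (fun x : X => val x) u [` xX]%fset.
  by move=> z zx; apply: mx; [exact: fsvalP|apply: contra zx => /eqP h; apply/eqP/val_inj].
have [y [my ey]] := exposed_maximizer_generic u [` xX]%fset hv.
have [s s0 [sx sy]] := near0_ex (near0_and (exposedat_near0 v hx) ey).
have m1 : strict_max X (u + s *: v) x.
  by move=> z zX zx; apply: (sx [` zX]%fset); apply: contra zx => /eqP h; have := congr1 (fun t : X => fsval t) h => /= ->.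
have m2 : strict_max X (- (u + s *: v)) (val y).
  move=> z zX zy; have := sy [` zX]%fset; rewrite !dotNl !dotNr; apply.
  by apply: contra zy => /eqP<-.
have sxy : strictly_antipodal X x (val y).
  apply/strictly_antipodalP; split=> //; first exact: fsvalP.
    apply/negP => /eqP xy; have [z zX zx] := exists_other x (affine_card affX).
    have := m2 z zX; rewrite -xy zx !dotNr ltrN2 => /(_ isT) h.
    by have := lt_trans h (m1 z zX zx); rewrite ltxx.
  by exists (u + s *: v).
by have [p [px _]] := exists_pair sxy; exists p.
Qed.

(** A constant sum determines the second point from the first, and every point has a partner, so the
    ordered pairs are in bijection with [X]. *)
Lemma constant_sum_card : (forall p q : pairs X, pair_sum p = pair_sum q) ->
  #|` X|%fset = (2 * sa X)%N.
Proof.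
move=> sumE; rewrite -card_pairs cardfE; apply/esym.
have inj : injective (fun p : pairs X => (val p).1).
  move=> p q E; apply: val_inj; rewrite [LHS]surjective_pairing [RHS]surjective_pairing E.
  congr (_, _); apply: val_inj; have := sumE p q; rewrite /pair_sum E; exact: addrI.
rewrite -(card_codom inj); apply: eq_card => x; rewrite [RHS]inE; apply/codomP.
have [p px] := exists_partner (fsvalP x).
by exists p; apply: val_inj.
Qed.

Lemma sa_dichotomy : (2 < d.+1)%N ->
  (2 * d.+1 <= sa X)%N \/ forall p q : pairs X, pair_sum p = pair_sum q.
Proof.
move=> d2; have C := pairs_conf affX.
have [nc|no] := pselect (nonconstant (@pair_sum R d X)).
  left; have := vertex_bound_ge3 d2 C nc; rewrite card_pairs /min_vertices.
  by case: eqP; lia.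
by right=> p q; apply/eqP; apply: contrapT => /negP h; apply: no; exists p, q.
Qed.

Lemma constant_sum_bound : (forall p q : pairs X, pair_sum p = pair_sum q) ->
  (2 * d.+1 <= #|` X|%fset)%N.
Proof.
by move=> /constant_sum_card ->; rewrite -card_pairs; exact: conf_card (pairs_conf affX).
Qed.

End Dichotomy.

(** * Cross-polytopes *)

Section Cross.
Context {R : realType} {d : nat} {X : {fset 'rV[R]_d.+1}}.
Hypotheses (affX : affine_hull X = [set: _]%classic) (scX : strictly_convex_position X).

(** One pair from each opposite couple gives [d.+1] half differences. They span the space, hence are
    independent, and the points of [X] are the centre plus or minus them. *)
Lemma symmetric_cross_polytope : #|` X|%fset = (2 * d.+1)%N ->
  (forall p q : pairs X, pair_sum p = pair_sum q) -> cross_polytope (convex_hull [set` X]).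
Proof.
move=> cX sumE; have C := pairs_conf affX.
have [p0 _] := conf_nonempty C; pose c := 2^-1 *: pair_sum p0.
have fstE (p : pairs X) : val (val p).1 = c + 2^-1 *: pair_diff p.
  rewrite /c (sumE p0 p) -scalerDr /pair_sum /pair_diff addrACA subrr addr0.
  by rewrite -mulr2n -scaler_nat scalerA mulVf ?scale1r // pnatr_eq0.
have cI : #|{: pairs X}| = (2 * d.+1)%N by rewrite card_pairs -constant_sum_card.
have [D1 [cD1 DE]] := exists_half C (D := [set: pairs X]%SET) (fun i _ => finset.in_setT _).
have cD : #|D1| = d.+1 by move: cD1; rewrite cardsT cI; lia.
have [p1 p1D] : exists p1, p1 \in D1 by apply/card_gt0P; rewrite cD.
have hD (p : pairs X) : p \in D1 \/ pair_swap p \in D1.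
  have : p \in D1 :|: [set pair_swap i | i in D1] by rewrite -DE inE.
  rewrite inE => /orP[|/imsetP[q qD ->]]; [by left|right].
  by rewrite (conf_oppK C).
pose f (i : 'I_d.+1) := enum_val (cast_ord (esym cD) i).
have fD i : f i \in D1 by exact: enum_valP.
have fsurj p : p \in D1 -> exists i, f i = p.
  move=> pD; exists (cast_ord cD (enum_rank_in p1D p)).
  by rewrite /f cast_ordK enum_rankK_in.
pose v : 'M[R]_d.+1 := \matrix_i (2^-1 *: pair_diff (f i)).
have rowv i : row i v = 2^-1 *: pair_diff (f i) by rewrite rowK.
exists c, v; split.
  rewrite /row_free -mxrank_tr -/(row_free v^T) -kermx_eq0.
  apply/negPn/negP => /rowV0Pn [n /sub_kermxP nv n0].
  have vn : v *m n^T = 0 by apply: trmx_inj; rewrite trmx_mul trmxK trmx0.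
  move/eqP: n0; apply; apply: trmx_inj; rewrite trmx0; apply: (conf_span C).
  have dD p : p \in D1 -> dot (pair_diff p) n^T = 0.
    move=> /fsurj [i <-]; have := congr1 (fun A : 'cV[R]_d.+1 => A i 0) vn.
    have -> : (v *m n^T) i 0 = dot (row i v) n^T by rewrite /dot -row_mul [RHS]mxE.
    rewrite rowv dotZl mxE => /eqP; rewrite mulf_eq0 invr_eq0 pnatr_eq0 /=.
    by move/eqP.
  move=> p; have [/dD//|/dD] := hD p.
  by rewrite (conf_opp C) dotNl => /eqP; rewrite oppr_eq0 => /eqP.
congr convex_hull; apply/seteqP; split=> [x xX|x [] [i _ <-]].
- have [p <-] := exists_partner affX scX xX; rewrite fstE.
  have [/fsurj [i <-]|/fsurj [i E]] := hD p; [left|right]; exists i => //; rewrite rowv //.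
  by rewrite E (conf_opp C) scalerN opprK.
- by rewrite rowv -fstE /=; exact: fsvalP.
- by rewrite rowv -scalerN -(conf_opp C) -fstE /=; exact: fsvalP.
Qed.

(** The polytope is symmetric about [p], hence so is its vertex set [X]. *)
Lemma cross_polytope_symmetric : cross_polytope (convex_hull [set` X]) ->
  exists c, forall x, x \in X -> c - x \in X.
Proof.
move=> [p [v [_ E]]]; exists (p *+ 2).
set A := (_ `|` _)%classic in E.
have symA z : A z -> A (p *+ 2 - z).
  case=> [[i _ <-]|[i _ <-]]; [right|left]; exists i => //.
    by rewrite opprD addrA mulr2n addrK.
    by rewrite opprB mulr2n addrA addrAC addrK.
have symH z : convex_hull [set` X] z -> convex_hull [set` X] (p *+ 2 - z).
  rewrite E; move: z; apply: smallest_sub; last by move=> z /symA; exact: sub_convex_hull.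
  apply: convex_set_intro => x y t hx hy t01.
  have -> : p *+ 2 - (t *: x + (1 - t) *: y) = t *: (p *+ 2 - x) + (1 - t) *: (p *+ 2 - y).
    rewrite !scalerBr addrACA -scalerDl addrC [t + _]addrC subrK scale1r addrC opprD.
    by [].
  by apply: convex_set_comb => //; apply: convex_hull_convex.
move=> x xX; have scE : [set` X]%classic = vert (convex_hull [set` X]) by exact: scX.
have : vert (convex_hull [set` X]) x by rewrite -scE.
move=> [H [a [b [a0 HE hle _]]] HP].
suff : vert (convex_hull [set` X]) (p *+ 2 - x) by rewrite -scE.
have [hx xH] : (convex_hull [set` X] `&` H)%classic x by rewrite HP.
have xb : dot x a = b by move: xH; rewrite HE.
exists (hyperplane (- a) (- dot (p *+ 2 - x) a)).
  exists (- a), (- dot (p *+ 2 - x) a); split=> //; first by rewrite oppr_eq0.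
    move=> z hz; rewrite /= -/(dot _ _) dotNr lerN2 dotDl dotNl xb.
    by have := hle _ (symH _ hz); rewrite /= -/(dot _ _) dotDl dotNl; lra.
  by exists (p *+ 2 - x); split; [exact: symH|rewrite /hyperplane /= -/(dot _ _) dotNr].
apply/seteqP; split=> [z [hz zH]|z ->]; last first.
  by split; [exact: symH|rewrite /hyperplane /= -/(dot _ _) dotNr].
have : (convex_hull [set` X] `&` H)%classic (p *+ 2 - z).
  split; first exact: symH.
  rewrite HE /hyperplane /= -/(dot _ _) dotDl dotNl.
  by move: zH; rewrite /hyperplane /= -/(dot _ _) dotNr dotDl dotNl; lra.
by rewrite HP => <-; rewrite opprB addrC subrK.
Qed.

Lemma cross_polytope_dichotomy : (2 < d.+1)%N -> #|` X|%fset = (2 * d.+1)%N ->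
  (cross_polytope (convex_hull [set` X]) /\ sa X = d.+1) \/
  (~ cross_polytope (convex_hull [set` X]) /\ (2 * d.+1 <= sa X)%N).
Proof.
move=> d2 cX; have [sumE|ns] := pselect (forall p q : pairs X, pair_sum p = pair_sum q).
  left; split; first exact: symmetric_cross_polytope.
  by have := constant_sum_card affX scX sumE; lia.
right; split.
  move=> /cross_polytope_symmetric [c sc]; apply: ns; exact: symmetric_pairs sc.
by have [//|/ns] := sa_dichotomy affX d2.
Qed.

End Cross.

(** * Examples with few strictly antipodal pairs *)

Section PointSet.
Context {R : realType} {d : nat} {J : finType} (P : J -> 'rV[R]_d.+1).

Definition point_set : {fset 'rV[R]_d.+1} := [fset x in [seq P j | j <- enum J]]%fset.

Lemma point_setP x : reflect (exists j, x = P j) (x \in point_set).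
Proof.
rewrite !inE; apply: (iffP mapP) => [[j _ ->]|[j ->]]; first by exists j.
by exists j; rewrite ?mem_enum.
Qed.

Lemma point_set_Cs (i0 : 'I_d.+1) : (1 < #|J|)%N ->
  (forall j, exists u, exposedat P u j) ->
  (forall i, delta_mx 0 i \in point_set) -> - delta_mx 0 i0 \in point_set ->
  Cs R d.+1 #|J| point_set.
Proof.
move=> cJ hP he hn.
have cX : #|` point_set|%fset = #|J|.
  have U : uniq [seq P j | j <- enum J].
    by rewrite map_inj_uniq ?enum_uniq //; exact: exposed_inj hP.
  by rewrite card_fseq undup_id // size_map cardE.
split=> //.
  apply/seteqP; split=> // y _.
  (* The coordinates of [y] serve as weights of the basis vectors; the weight missing to 1 is split
     equally between one basis vector and its negative, where it cancels. *)
  pose t := (1 - \sum_i y 0 i) / 2.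
  pose w (x : 'rV[R]_d.+1) := \sum_i (x == delta_mx 0 i)%:R * y 0 i + (x == delta_mx 0 i0)%:R * t
              + (x == - delta_mx 0 i0)%:R * t : R.
  have pick1 (z : 'rV[R]_d.+1) : z \in point_set -> \sum_(x <- point_set) (x == z)%:R = 1 :> R.
    move=> zX; rewrite (bigD1_seq z) ?fset_uniq // eqxx big1 => [|x /negbTE -> //].
    exact: addr0.
  have pick (z : 'rV[R]_d.+1) : z \in point_set -> \sum_(x <- point_set) (x == z)%:R *: x = z.
    move=> zX; rewrite (bigD1_seq z) ?fset_uniq // eqxx big1 => [|x /negbTE ->]; last by rewrite scale0r.
    by rewrite /= addr0 scale1r.
  exists w; split.
    rewrite /w !big_split /= exchange_big /= -!mulr_suml !pick1 //.
    under eq_bigr do rewrite -mulr_suml pick1 // mul1r.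
    by rewrite /t; field.
  rewrite /w; under eq_bigr do rewrite !scalerDl scaler_suml.
  rewrite !big_split /= exchange_big /=.
  have pull (z : 'rV[R]_d.+1) (c : R) : z \in point_set ->
      \sum_(x <- point_set) ((x == z)%:R * c) *: x = c *: z.
    move=> zX; rewrite -[in RHS](pick z zX) scaler_sumr; apply: eq_bigr => x _.
    by rewrite scalerA mulrC.
  rewrite !pull // scalerN addrK.
  under eq_bigr do rewrite pull //.
  by rewrite [LHS]row_sum_delta.
apply: exposed_strictly_convex; first by rewrite cX.
move=> x /point_setP [j ->]; have [u hu] := hP j; exists u.
by move=> z /point_setP [j' ->] ne; apply: hu; apply: contra ne => /eqP->.
Qed.

End PointSet.

Section Truncated.
Context {R : realType} {d : nat}.
Notation D := d.+1.

Lemma dot_delta i (u : 'cV[R]_D) : dot (delta_mx 0 i) u = u i 0.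
Proof. by rewrite /dot -rowE mxE. Qed.

Lemma delta_col (i j : 'I_D) : (delta_mx i 0 : 'cV[R]_D) j 0 = (j == i)%:R.
Proof. by rewrite mxE andbT. Qed.

(** Needed because [sa_min] is 0 on an empty family. The example consists of the basis and the
    negatives of its first vectors. *)
Lemma nonempty_Cs n : (d.+1 + 2 <= n <= 2 * d.+1 - 1)%N -> exists X, Cs R d.+1 n X.
Proof.
move=> hn; have kD : (n - d.+1 <= d.+1)%N by lia.
have k0 : (0 < n - d.+1)%N by lia.
pose P (j : 'I_d.+1 + 'I_(n - d.+1)) : 'rV[R]_d.+1 :=
  match j with inl i => delta_mx 0 i | inr i => - delta_mx 0 (widen_ord kD i) end.
have cJ : #|{: 'I_d.+1 + 'I_(n - d.+1)}| = n by rewrite card_sum !card_ord; lia.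
exists (point_set P); rewrite -[in X in Cs R _ X]cJ.
apply: (@point_set_Cs _ _ _ P ord0).
- by rewrite cJ; lia.
- have le01 (b : bool) : 0 <= b%:R :> R by exact: ler0n.
  move=> [i|i].
    exists (delta_mx i 0) => -[j|j] ne; rewrite /P ?dotNl !dot_delta !delta_col eqxx /= ?mulr1n.
      have ji : j != i by apply: contra ne => /eqP->.
      by rewrite (negbTE ji) /= ?mulr0n; lra.
    by have := le01 (widen_ord kD j == i); lra.
  exists (- delta_mx (widen_ord kD i) 0) => -[j|j] ne; rewrite /P ?dotNl !dotNr !dot_delta !delta_col eqxx /= ?mulr1n.
    by have := le01 (j == widen_ord kD i); lra.
  have ji : widen_ord kD j != widen_ord kD i.
    by apply: contra ne => /eqP E; apply/eqP; congr inr; apply: val_inj; exact: (congr1 val E).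
  by rewrite (negbTE ji) /= ?mulr0n; lra.
- by move=> i; apply/point_setP; exists (inl i).
- apply/point_setP; exists (inr (Ordinal k0)); rewrite /P; congr (- delta_mx _ _).
  exact: val_inj.
Qed.


Hypothesis d2 : (2 <= d)%N.

Definition apex_coef : R := d%:R^-1.

Lemma apex_coefE : apex_coef * d%:R = 1.
Proof. by rewrite mulVf // pnatr_eq0; lia. Qed.

Lemma apex_coef_gt0 : 0 < apex_coef.
Proof. by rewrite invr_gt0 ltr0n; lia. Qed.

Lemma apex_coef_le : apex_coef <= 1 / 2.
Proof.
have : 2%:R <= d%:R :> R by rewrite ler_nat.
by have := apex_coefE; have := apex_coef_gt0; nra.
Qed.

Definition apex : 'rV[R]_D := const_mx apex_coef.

Lemma dot_apex u : dot apex u = apex_coef * \sum_i u i 0.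
Proof.
by rewrite /dot mxE mulr_sumr; apply: eq_bigr => i _; rewrite mxE.
Qed.

(** One coordinate is [M] and the other [d] are at least [- M], so the sum is at least
    [M - d%:R * M]; here [d] is one less than the dimension, and [apex] divides the sum by [d]. *)
Lemma dot_apex_ge (u : 'cV[R]_D) M p : (forall i, - M <= u i 0) -> u p 0 = M -> - M <= dot apex u.
Proof.
move=> hM hp; rewrite dot_apex.
have M0 : 0 <= M by have := hM p; rewrite hp; lra.
have : 2 * M <= \sum_i (u i 0 + M).
  rewrite (bigD1 p) //= hp.
  have : 0 <= \sum_(i | i != p) (u i 0 + M) by apply: sumr_ge0 => i _; have := hM i; lra.
  lra.
rewrite big_split /= sumr_const card_ord -[M *+ _]mulr_natr.
have -> : D%:R = d%:R + 1 :> R by rewrite natr1.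
set S := \sum_i _; have := apex_coefE; have := apex_coef_gt0; have := apex_coef_le.
move: apex_coef (d%:R : R) => al n al1 al0 E h.
have : al * (2 * M - M * (n + 1)) <= al * S by rewrite ler_pM2l //; lra.
have -> : al * (2 * M - M * (n + 1)) = al * M - (al * n) * M by ring.
rewrite E; nra.
Qed.

Lemma dot_apex_le (u : 'cV[R]_D) M p : (forall i, u i 0 <= M) -> u p 0 = - M -> dot apex u <= M.
Proof.
move=> hM hp; have := @dot_apex_ge (- u) M p; rewrite dotNr mxE hp opprK lerN2; apply=> // i.
by rewrite mxE lerN2.
Qed.

Section Points.
Variables (k m : nat) (tau : R).
Hypotheses (hk : (k <= D)%N) (hm : (0 < m <= D)%N)
  (htau : (tau = 1 /\ m = 1%N) \/ (tau = 1 / 2 /\ m = D)).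

(** The first [k] upper points are midpoints of a basis vector and [apex]. Below, either [- apex]
    itself is added ([tau = 1], [m = 1]), or the [D] midpoints of [- apex] and the negatives of the
    upper points ([tau = 1 / 2], [m = D]). *)
Definition cut_coef (i : 'I_D) : R := if (i < k)%N then 1 / 2 else 0.
Definition upper_point i : 'rV[R]_D := (1 - cut_coef i) *: delta_mx 0 i + cut_coef i *: apex.
Definition lower_point i : 'rV[R]_D := (1 - tau) *: upper_point i + tau *: apex.

Lemma cut_coefP i : cut_coef i = 0 \/ cut_coef i = 1 / 2.
Proof. by rewrite /cut_coef; case: ifP; [right|left]. Qed.

Lemma tauP : tau = 1 / 2 \/ tau = 1.
Proof. by case: htau => -[-> _]; [right|left]. Qed.

Lemma dot_upper i u : dot (upper_point i) u = (1 - cut_coef i) * u i 0 + cut_coef i * dot apex u.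
Proof. by rewrite dotDl !dotZl dot_delta. Qed.

Lemma dot_lower i u : dot (lower_point i) u = (1 - tau) * dot (upper_point i) u + tau * dot apex u.
Proof. by rewrite dotDl !dotZl. Qed.

Definition truncated_index := (('I_D + 'I_D) + ('I_k + 'I_m))%type.

Definition truncated_point (j : truncated_index) : 'rV[R]_D :=
  match j with
  | inl (inl i) => delta_mx 0 i
  | inl (inr i) => - delta_mx 0 i
  | inr (inl i) => upper_point (widen_ord hk i)
  | inr (inr i) => - lower_point (widen_ord (andP hm).2 i)
  end.

Definition truncated := point_set truncated_point.

(* All [upper_point i] belong to the set, since [upper_point i] is a basis vector
   when [cut_coef i = 0]; so do all [- lower_point i], which coincide for [tau = 1]. *)
Lemma truncatedP x : x \in truncated <->
  exists i, [\/ x = delta_mx 0 i, x = - delta_mx 0 i, x = upper_point i | x = - lower_point i].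
Proof.
split=> [/point_setP [[[i|i]|[i|i]] ->]|[i [->|->|->|->]]].
- by exists i; constructor 1.
- by exists i; constructor 2.
- by exists (widen_ord hk i); constructor 3.
- by exists (widen_ord (andP hm).2 i); constructor 4.
- by apply/point_setP; exists (inl (inl i)).
- by apply/point_setP; exists (inl (inr i)).
- apply/point_setP; have [ik|ki] := ltnP i k.
    by exists (inr (inl (Ordinal ik))); congr upper_point; apply: val_inj.
  exists (inl (inl i)); rewrite /upper_point /cut_coef ltnNge ki /=.
  by rewrite subr0 scale1r scale0r addr0.
- apply/point_setP; case: htau => -[tE mE].
    have m0 : (0 < m)%N by rewrite mE.
    exists (inr (inr (Ordinal m0))); rewrite /= /lower_point tE.
    by rewrite subrr !scale0r !add0r.
  have im : (i < m)%N by rewrite mE.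
  by exists (inr (inr (Ordinal im))); congr (- lower_point _); apply: val_inj.
Qed.

Lemma lower_point_neq i j : - lower_point i != delta_mx 0 j.
Proof.
apply/eqP => E; have a0 := apex_coef_gt0.
have := congr1 (fun x => dot x (delta_mx j 0)) E.
rewrite dotNl dot_lower dot_upper dot_delta dot_apex !mxE !eqxx /=.
have -> : \sum_i (delta_mx j 0 : 'cV[R]_D) i 0 = 1.
  rewrite (bigD1 j) //= mxE !eqxx big1 ?addr0 // => l /negbTE lj.
  by rewrite mxE lj.
case: tauP => ->; case: (cut_coefP i) => ->; case: (i == j) => /=; lra.
Qed.

(** As both extremes are unique, it suffices, for each form of the maximum [x], to find a point with
    minimal value. Values at upper and lower points are averages of a coordinate [a i] and the value
    [s] of [apex], so bounds for these are enough. *)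
Lemma truncated_antipodal x y : strictly_antipodal truncated x y ->
  exists i, [fset x; y]%fset = [fset delta_mx 0 i; - delta_mx 0 i]%fset \/
            [fset x; y]%fset = [fset upper_point i; - lower_point i]%fset.
Proof.
move=> /strictly_antipodalP [xX yX _ [u [mx my]]].
have min_is c : c \in truncated -> (forall z, z \in truncated -> dot c u <= dot z u) -> y = c.
  move=> cX hc; apply/eqP; apply: contrapT => /negP ne.
  have := my c cX; rewrite eq_sym ne !dotNr ltrN2 => /(_ isT).
  by rewrite ltNge hc.
have max_is c : c \in truncated -> dot x u <= dot c u -> x = c.
  move=> cX hc; apply/eqP; apply: contrapT => /negP ne.
  by have := mx c cX; rewrite eq_sym ne => /(_ isT); rewrite ltNge hc.
have mxl z : z \in truncated -> dot z u <= dot x u.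
  by move=> zX; have [->//|/(mx z zX)/ltW] := eqVneq z x.
have inE1 i : delta_mx 0 i \in truncated by apply/truncatedP; exists i; constructor 1.
have inE2 i : - delta_mx 0 i \in truncated by apply/truncatedP; exists i; constructor 2.
have inY i : upper_point i \in truncated by apply/truncatedP; exists i; constructor 3.
have inZ i : - lower_point i \in truncated by apply/truncatedP; exists i; constructor 4.
pose s := dot apex u; pose a i := u i 0.
have h1 i : a i <= dot x u by rewrite /a -dot_delta; exact: mxl.
have h2 i : - a i <= dot x u by rewrite /a -dot_delta -dotNl; exact: mxl.
pose Y i := (1 - cut_coef i) * a i + cut_coef i * s.
pose Z i := (1 - tau) * Y i + tau * s.
have h3 i : Y i <= dot x u by rewrite /Y -dot_upper; exact: mxl.
have h4 i : - Z i <= dot x u by rewrite /Z /Y -dot_upper -dot_lower -dotNl; exact: mxl.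
have minE c : c \in truncated ->
    (forall i, [/\ dot c u <= a i, dot c u <= - a i, dot c u <= Y i & dot c u <= - Z i]) -> y = c.
  move=> cX hc; apply: min_is => // z /truncatedP [i]; have [c1 c2 c3 c4] := hc i.
  by case=> ->; rewrite ?dotNl ?dot_lower ?dot_upper ?dot_delta.
have Ycase i M : (a i <= M -> s <= M -> Y i <= M) /\ (M <= a i -> M <= s -> M <= Y i).
  by rewrite /Y; case: (cut_coefP i) => ->; split; lra.
have Zcase i M : (Y i <= M -> s <= M -> Z i <= M) /\ (M <= Y i -> M <= s -> M <= Z i).
  by rewrite /Z; case: tauP => ->; split; lra.
have sge p : (forall i, - a p <= a i) -> - a p <= s by move=> h; apply: (@dot_apex_ge u _ p).
have sle p : (forall i, a i <= - a p) -> s <= - a p.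
  by move=> h; apply: (@dot_apex_le u _ p) => //; rewrite opprK.
have up p : (forall i, Y i <= Y p) -> (forall i, a i <= Y p) -> (forall i, - a i <= Y p) ->
    Y p <= s -> y = - lower_point p.
  move=> g1 g2 g3 g4.
  have Zp : Y p <= Z p by apply: (Zcase p _).2.
  have Y0 : 0 <= Y p by have := g2 p; have := g3 p; lra.
  apply: minE => // i; rewrite dotNl dot_lower dot_upper -/s -/(a p) -/(Y p) -/(Z p).
  have Yi : - Y p <= Y i by apply: (Ycase i _).2; have := g3 i; lra.
  split; [have := g3 i|have := g2 i| |]; try lra.
  by rewrite lerN2 /Z; have := g1 i; case: tauP => ->; lra.
have upper0 p : cut_coef p = 0 -> upper_point p = delta_mx 0 p.
  by rewrite /upper_point => ->; rewrite subr0 scale1r scale0r addr0.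
have caseE p : x = delta_mx 0 p ->
    exists i, [fset x; y]%fset = [fset delta_mx 0 i; - delta_mx 0 i]%fset \/
              [fset x; y]%fset = [fset upper_point i; - lower_point i]%fset.
  move=> xE.
  have E : dot x u = a p by rewrite xE dot_delta.
  have sM : - a p <= s by apply: sge => i; have := h2 i; rewrite E; lra.
  (* If [apex] is higher than the maximum [delta_mx 0 p], this basis vector cannot have been cut,
     and it is its own upper point. *)
  have [sp|sp] := leP s (a p).
    exists p; left; congr [fset _; _]%fset => //; apply: minE => // i.
    rewrite dotNl dot_delta -/(a p); have := h1 i; have := h2 i; have := h3 i; have := h4 i.
    rewrite E => k4 k3 k2 k1.
    have y1 : Y i <= a p by [].
    have y2 : - a p <= Y i by apply: (Ycase i _).2 => //; lra.
    have z1 : Z i <= a p by apply: (Zcase i _).1.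
    by split; lra.
  have c0 : cut_coef p = 0.
    case: (cut_coefP p) => // c; have := h3 p; rewrite E /Y c; lra.
  have Yp : Y p = a p by rewrite /Y c0; lra.
  exists p; right; rewrite xE; congr [fset _; _]%fset.
    by rewrite upper0.
  by apply: up => [i|i|i|]; rewrite Yp -?E // ltW // E.
move: xX => /truncatedP [p [] xE]; first exact: caseE xE.
- have E : dot x u = - a p by rewrite xE dotNl dot_delta.
  have sM : s <= - a p by apply: sle => i; have := h1 i; rewrite E.
  have sm : a p <= s.
    by have := h4 p; rewrite E /Z /Y; case: tauP => ->; case: (cut_coefP p) => ->; lra.
  exists p; left; rewrite fsetUC; congr [fset _; _]%fset => //; apply: minE => // i.
  rewrite dot_delta -/(a p); have := h1 i; have := h2 i; have := h3 i; have := h4 i.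
  rewrite E => k4 k3 k2 k1.
  have y2 : a p <= Y i by apply: (Ycase i _).2 => //; lra.
  have z1 : Z i <= - a p by apply: (Zcase i _).1.
  by split; lra.
- have [c0|c1] := cut_coefP p; first by apply: (caseE p); rewrite xE upper0.
  have E : dot x u = Y p by rewrite xE dot_upper.
  exists p; right; congr [fset _; _]%fset => //.
  apply: up => [i|i|i|]; rewrite -?E //.
  by have := h1 p; rewrite E /Y c1; lra.
(* The lowest upper point [q] makes [- lower_point q] at least as high as [x], so the two are equal.
   It remains to show that no other point lies below [upper_point q]. *)
have [q qmin] : exists q, forall i, Y q <= Y i.
  case: (@arg_minP _ _ _ p predT Y isT) => q _ hq; exists q => i; exact: hq.
have xq : x = - lower_point q.
  apply: max_is => //; rewrite xE !dotNl lerN2 !dot_lower !dot_upper -/s -!/(a _) -!/(Y _).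
  by have := qmin p; case: tauP => ->; lra.
have E : dot x u = - Z q by rewrite xq dotNl dot_lower dot_upper.
have strict i : a i < - Z q.
  have := mx (delta_mx 0 i) (inE1 i); rewrite E dot_delta; apply.
  by rewrite xq eq_sym lower_point_neq.
have Ya i : Y q <= a i.
  rewrite leNgt; apply/negP => lt; have k2 := h2 i; rewrite E in k2.
  have sY : Y q <= s.
    have := qmin i; have -> : Y i = (1 - cut_coef i) * a i + cut_coef i * s by [].
    by case: (cut_coefP i) => ->; lra.
  by have : Y q <= Z q by [apply: (Zcase q _).2]; lra.
have Yna i : Y q <= - a i.
  rewrite leNgt; apply/negP => lt.
  have [t _ tmax] := @arg_maxP _ _ _ i predT a isT.
  have at_i : a i <= a t by apply: tmax.
  have st : - a t <= s by apply: sge => j; have := Ya j; lra.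
  have : - a t <= Z q by apply: (Zcase q _).2 => //; lra.
  by have := strict t; lra.
have sY : s <= - Y q.
  case: (cut_coefP q) => c.
    have Yq : Y q = a q by rewrite /Y c; lra.
    by rewrite Yq; apply: sle => i; have := Yna i; rewrite Yq; lra.
  by have := Ya q; have := Yna q; rewrite /Y c; lra.
exists q; right; rewrite fsetUC xq; congr [fset _; _]%fset => //.
apply: minE => // i; rewrite dot_upper -/s -/(a q) -/(Y q).
have yi : Y i <= - Y q by apply: (Ycase i _).1 => //; have := Yna i; lra.
have zi : Z i <= - Y q by apply: (Zcase i _).1.
by split=> //; lra.
Qed.

Lemma truncated_sa : (sa truncated <= 2 * D)%N.
Proof.
pose f (i : 'I_D + 'I_D) : {fset 'rV[R]_D} := match i with
  | inl i => [fset delta_mx 0 i; - delta_mx 0 i]%fset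
  | inr i => [fset upper_point i; - lower_point i]%fset end.
have : (#|` [fset x in [seq f i | i <- enum {: 'I_D + 'I_D}]]%fset| <= 2 * D)%N.
  rewrite card_fseq (leq_trans (size_undup _)) // size_map -cardE card_sum !card_ord; lia.
apply: leq_trans; apply: fsubset_leq_card; apply/fsubsetP => A.
rewrite !inE => /andP[_ /asboolP [x [y [/truncated_antipodal [i E] AE]]]].
by rewrite AE; apply/mapP; case: E => ->; [exists (inl i)|exists (inr i)]; rewrite ?mem_enum.
Qed.

Lemma dot_apex_delta i : dot apex (delta_mx i 0) = apex_coef.
Proof. by rewrite /dot -colE !mxE. Qed.

Lemma truncated_exposed j : exists u, exposedat truncated_point u j.
Proof.
have al0 := apex_coef_gt0; have al1 := apex_coef_le.
(* Signed basis vectors are exposed by the signed coordinates, the added points by plus or minus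
   [T i]. At [T i] the value of [apex] exceeds that of every basis vector, and the extra weight on
   coordinate [i] favours the point with index [i]. *)
pose T (i : 'I_D) : 'cV[R]_D := const_mx 1 + apex_coef *: delta_mx i 0.
have dotT l i : dot (delta_mx 0 l) (T i) = 1 + apex_coef * (l == i)%:R.
  by rewrite dotDr dotZr !dot_delta mxE delta_col.
have apexT i : dot apex (T i) = 1 + apex_coef + apex_coef ^+ 2.
  rewrite dotDr dotZr dot_apex_delta dot_apex.
  under eq_bigr do rewrite mxE.
  rewrite sumr_const card_ord -natr1 mulrDr apex_coefE mulr1; ring.
have b01 (b : bool) : 0 <= (b%:R : R) <= 1 by case: b; rewrite ?lexx ?ler01.
have upD l i : 0 <= dot (upper_point l) (delta_mx i 0) <= 1.
  rewrite dot_upper delta_col dot_apex_delta; have := b01 (l == i).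
  by move=> /andP[? ?]; case: (cut_coefP l) => ->; lra.
have loD l i : 0 <= dot (lower_point l) (delta_mx i 0) < 1.
  rewrite dot_lower dot_apex_delta; have /andP[? ?] := upD l i.
  by case: tauP => ->; lra.
have aa : 0 < apex_coef ^+ 2 < apex_coef by rewrite expr2; apply/andP; split; nra.
have upT l i : dot (upper_point l) (T i) = (1 - cut_coef l) * (1 + apex_coef * (l == i)%:R)
    + cut_coef l * (1 + apex_coef + apex_coef ^+ 2).
  by rewrite dotDl !dotZl dotT apexT.
have upT_same i : 1 + apex_coef <= dot (upper_point i) (T i).
  by rewrite upT eqxx /= mulr1; case: (cut_coefP i) => ->; case/andP: aa; lra.
have upT_other l i : l != i -> 1 <= dot (upper_point l) (T i) < 1 + apex_coef.
  move=> /negbTE li; rewrite upT li /= mulr0; case/andP: aa.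
  by case: (cut_coefP l) => ->; lra.
have upT1 l i : 1 <= dot (upper_point l) (T i).
  by have [->|/upT_other/andP[]//] := eqVneq l i; have := upT_same i; lra.
have loT l i : dot (lower_point l) (T i) = (1 - tau) * dot (upper_point l) (T i)
    + tau * (1 + apex_coef + apex_coef ^+ 2) by rewrite dot_lower apexT.
have loT1 l i : 1 <= dot (lower_point l) (T i).
  by rewrite loT; have := upT1 l i; case/andP: aa; case: tauP => ->; lra.
have eT l i : 1 <= dot (delta_mx 0 l) (T i) <= 1 + apex_coef.
  by rewrite dotT; have /andP[? ?] := b01 (l == i); nra.
have cutw (i : 'I_k) : cut_coef (widen_ord hk i) = 1 / 2 by rewrite /cut_coef /= ltn_ord.
case: j => [[i|i]|[i|i]].
- exists (delta_mx i 0) => -[[l|l]|[l|l]] ne; rewrite /truncated_point ?dotNl.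
  + have li : l != i by apply: contra ne => /eqP->.
    by rewrite !dot_delta !delta_col eqxx (negbTE li) ltr01.
  + rewrite !dot_delta !delta_col eqxx; have /andP[? _] := b01 (l == i).
    by apply: le_lt_trans ltr01; rewrite oppr_le0.
  + rewrite dot_upper cutw !dot_delta !delta_col eqxx dot_apex_delta.
    by have /andP[? ?] := b01 (widen_ord hk l == i); rewrite mulr1n; lra.
  + rewrite dot_delta delta_col eqxx; have /andP[? _] := loD (widen_ord (andP hm).2 l) i.
    by apply: le_lt_trans ltr01; rewrite oppr_le0.
- exists (- delta_mx i 0) => -[[l|l]|[l|l]] ne; rewrite /truncated_point ?dotNl !dotNr ?opprK.
  + rewrite !dot_delta !delta_col eqxx; have /andP[? _] := b01 (l == i).
    by apply: le_lt_trans ltr01; rewrite oppr_le0.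
  + have li : l != i by apply: contra ne => /eqP->.
    by rewrite !dot_delta !delta_col eqxx (negbTE li) ltr01.
  + rewrite [X in _ < X]dot_delta delta_col eqxx; have /andP[? _] := upD (widen_ord hk l) i.
    by apply: le_lt_trans ltr01; rewrite oppr_le0.
  + rewrite [X in _ < X]dot_delta delta_col eqxx.
    by have /andP[_ ?] := loD (widen_ord (andP hm).2 l) i.
- exists (T (widen_ord hk i)) => -[[l|l]|[l|l]] ne; rewrite /truncated_point ?dotNl.
  + have /andP[_ h] := eT l (widen_ord hk i); apply: (le_lt_trans h).
    by rewrite upT cutw eqxx mulr1; case/andP: aa; lra.
  + have /andP[h _] := eT l (widen_ord hk i); have := upT1 (widen_ord hk i) (widen_ord hk i); lra.
  + have li : widen_ord hk l != widen_ord hk i.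
      by apply: contra ne => /eqP E; apply/eqP; congr (inr (inl _)); apply: val_inj; exact: (congr1 val E).
    have /andP[_ h] := upT_other _ _ li; apply: (lt_le_trans h); exact: upT_same.
  + have := loT1 (widen_ord (andP hm).2 l) (widen_ord hk i).
    by have := upT1 (widen_ord hk i) (widen_ord hk i); lra.
exists (- T (widen_ord (andP hm).2 i)) => -[[l|l]|[l|l]] ne; rewrite /truncated_point ?dotNl !dotNr ?opprK.
- have /andP[h _] := eT l (widen_ord (andP hm).2 i).
  by have := loT1 (widen_ord (andP hm).2 i) (widen_ord (andP hm).2 i); lra.
- have /andP[_ h] := eT l (widen_ord (andP hm).2 i); apply: (le_lt_trans h).
  rewrite loT; have := upT_same (widen_ord (andP hm).2 i); case/andP: aa.
  by case: tauP => ->; lra.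
- have := loT1 (widen_ord (andP hm).2 i) (widen_ord (andP hm).2 i).
  by have := upT1 (widen_ord hk l) (widen_ord (andP hm).2 i); lra.
have nil : l != i by apply: contra ne => /eqP->.
have li : widen_ord (andP hm).2 l != widen_ord (andP hm).2 i.
  by apply: contra nil => /eqP E; apply/eqP; apply: val_inj; exact: (congr1 val E).
case: htau => -[tE mE].
  by case/eqP: nil; apply: ord_inj; have := ltn_ord l; have := ltn_ord i; lia.
rewrite !loT tE; have /andP[_ h] := upT_other _ _ li.
by have := upT_same (widen_ord (andP hm).2 i); lra.
Qed.

Lemma truncated_Cs : Cs R D (2 * D + (k + m)) truncated.
Proof.
have cJ : #|{: truncated_index}| = (2 * D + (k + m))%N.
  by rewrite /truncated_index !card_sum !card_ord; lia.
rewrite -cJ; apply: (@point_set_Cs _ _ _ truncated_point ord0).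
- by rewrite cJ; lia.
- exact: truncated_exposed.
- by move=> i; apply/truncatedP; exists i; constructor 1.
- by apply/truncatedP; exists ord0; constructor 2.
Qed.

End Points.

Lemma exists_small_sa n : (2 * D + 1 <= n <= 4 * D - 1)%N ->
  exists2 X, Cs R D n X & (sa X <= 2 * D)%N.
Proof.
(* Up to [3 * D + 1] points a single lower point suffices; beyond that, all [D] lower points are
   taken. *)
move=> hn; have [h|h] := leqP n (3 * D + 1).
  have hk : (n - (2 * D + 1) <= D)%N by lia.
  have hm : (0 < 1 <= D)%N by lia.
  have ht : (1 = 1 :> R /\ 1%N = 1%N) \/ (1 = 1 / 2 :> R /\ 1%N = D) by left.
  exists (truncated 1 hk hm); last exact: truncated_sa ht.
  by have := truncated_Cs hk hm ht; congr (Cs _ _ _ _); lia.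
have hk : (n - 3 * D <= D)%N by lia.
have hm : (0 < D <= D)%N by lia.
have ht : (1 / 2 = 1 :> R /\ D = 1%N) \/ (1 / 2 = 1 / 2 :> R /\ D = D) by right.
exists (truncated (1 / 2) hk hm); last exact: truncated_sa ht.
by have := truncated_Cs hk hm ht; congr (Cs _ _ _ _); lia.
Qed.

End Truncated.

(** * The three statements *)

Theorem theorem2p4 (R : realType) (d : nat) (hd : (3 <= d)%N) :
  [/\ forall n : nat, (2 * d + 1 <= n <= 4 * d - 1)%N -> odd n ->
        sa_min R d n = (2 * d)%N,
      forall n : nat, (d + 2 <= n <= 2 * d - 1)%N ->
        (2 * d <= sa_min R d n)%N
    & forall X : {fset 'rV[R]_d}, Cs R d (2 * d)%N X ->
        (cross_polytope (convex_hull [set` X]) /\ sa X = d) \/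
        (~ cross_polytope (convex_hull [set` X]) /\ (2 * d <= sa X)%N)].
Proof.
case: d hd => // d hd; split.
- move=> n hn on.
  have low X : Cs R d.+1 n X -> (2 * d.+1 <= sa X)%N.
    move=> [cX aX sX]; have [//|h] := sa_dichotomy aX hd.
    (* A constant sum would make the number of points equal to [2 * sa X], hence even. *)
    by move: on; rewrite -cX (constant_sum_card aX sX h) oddM.
  have [X CX sX] := exists_small_sa (R := R) (d := d) hd hn.
  have E : sa X = (2 * d.+1)%N by apply/eqP; rewrite eqn_leq sX low.
  apply: xget_unique.
    by split; [exists X|move=> _ [Y /low ? <-]].
  move=> y [[Y CY <-] lbY]; apply/eqP; rewrite eqn_leq low // andbT -E.
  by apply: lbY; exists X.
- move=> n hn; have [X CX] := nonempty_Cs (R := R) hn.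
  have low Y : Cs R d.+1 n Y -> (2 * d.+1 <= sa Y)%N.
    move=> [cX aX sX]; have [//|h] := sa_dichotomy aX hd.
    by have := constant_sum_bound aX sX h; rewrite cX; lia.
  (* The family is nonempty, so a minimum exists and [xget] does not return its default. *)
  have ex : exists v, `[< exists2 Y, Cs R d.+1 n Y & sa Y = v >] by exists (sa X); apply/asboolP; exists X.
  case: (ex_minnP ex) => v /asboolP [Y CY Yv] vmin.
  rewrite /sa_min; case: xgetP => [z -> [[Z CZ <-] _]|no]; first exact: low.
  case: (no v); split; first by exists Y.
  by move=> _ [Z CZ <-]; apply: vmin; apply/asboolP; exists Z.
by move=> X [cX aX sX]; exact: cross_polytope_dichotomy.
Qed.
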